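(* Let $d\ge 1$ be a fixed integer, let $\omega=\omega(n)\to\infty$ as $n\to\infty$, and let $p=p(n)\in[0,1]$. Consider the random embedded graph $\mathcal X_{n,p}$ in $[0,1]^d$. (a) If $p\le \frac{1}{\omega^d(\log\log n)^{2d}}\cdot\frac{\log^d n}{n}$ for all (large) $n$, then for any two fixed distinct vertices $u,v$, $$\mathrm{dist}(u,v)\ \ge\ \frac{\omega}{8de^d}\qquad\text{a.a.s.}$$ (b) If $p\ge \frac{\omega\log^d n}{n}$ for all (large) $n$, then a.a.s., uniformly for all vertices $u,v$, $$\mathrm{dist}(u,v)=\|u-v\|+o(1);$$ that is, for every $\varepsilon>0$, with probability tending to $1$ as $n\to\infty$, all pairs of vertices $u,v$ of $\mathcal X_{n,p}$ satisfy $\|u-v\|\le \mathrm{dist}(u,v)\le\|u-v\|+\varepsilon$.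
   Context: $\mathcal X_{n,p}$ is the following random graph. Points $X_1,\dots,X_n$ are chosen independently and uniformly at random in the cube $[0,1]^d$; vertex $i\in[n]=\{1,\dots,n\}$ is placed at $X_i$. Independently of the positions, each pair of vertices is joined by an edge independently with probability $p$. Each edge has length equal to the Euclidean distance between its endpoints. $\|u-v\|$ denotes the Euclidean distance between (the positions of) vertices $u,v$, and $\mathrm{dist}(u,v)$ denotes the minimum total Euclidean edge length of a path from $u$ to $v$ in the graph ($+\infty$ if there is no path). A sequence of events $\mathcal E_n$ holds asymptotically almost surely (a.a.s.) if $\lim_{n\to\infty}\Pr(\neg\mathcal E_n)=0$. $\log$ is the natural logarithm, and $\log^d n=(\log n)^d$. *)

(* Defs.v *)
From HB Require Import structures.
From mathcomp Require Import all_boot all_order all_algebra.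
From mathcomp Require Import all_classical all_reals all_analysis.

Set Implicit Arguments.
Unset Strict Implicit.
Unset Printing Implicit Defensive.

Import Order.TTheory GRing.Theory Num.Theory.
Import numFieldTopology.Exports numFieldNormedType.Exports.

Local Open Scope classical_set_scope.
Local Open Scope ring_scope.

(* The norm that MathComp-Analysis puts on vectors is the sup norm, hence this
   explicit Euclidean distance. *)
Definition eucl_dist (R : realType) (d : nat) (x y : d.-tuple R) : R :=
  Num.sqrt (\sum_(k < d) (tnth x k - tnth y k) ^+ 2).

Definition path_length (R : realType) (d n : nat) (x : 'I_n -> d.-tuple R)
    (u : 'I_n) (s : seq 'I_n) : R :=
  \sum_(l <- pairmap (fun i j => eucl_dist (x i) (x j)) u s) l.

(* A path from u to v is u :: s without repeated vertices; there are finitely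
   many of them, so the infimum is a minimum, and it is +oo if there is none. *)
Definition graph_dist (R : realType) (d n : nat) (x : 'I_n -> d.-tuple R)
    (G : rel 'I_n) (u v : 'I_n) : \bar R :=
  ereal_inf [set (path_length x u s)%:E | s in
    [set s : seq 'I_n | [/\ path G u s, last u s = v & uniq (u :: s)]]].

Definition mutually_independent (dT : measure_display) (T : measurableType dT)
    (R : realType) (P : probability T R) (I : finType)
    (F : I -> set (set T)) : Prop :=
  forall (J : {set I}) (A : I -> set T),
    (forall i, i \in J -> F i (A i)) ->
    P (\bigcap_(i in [set` J]) A i) = (\prod_(i in J) P (A i))%E.

(* The uniform law on [0,1]^d is the d-fold product of the uniform law on
   [0,1], i.e. it is determined by its values on measurable boxes. *)
Definition uniform_on_cube (dT : measure_display) (T : measurableType dT)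
    (R : realType) (P : probability T R) (d : nat)
    (X : {RV P >-> d.-tuple R}) : Prop :=
  forall A : 'I_d -> set R, (forall k, measurable (A k)) ->
    distribution P X [set x | forall k, A k (tnth x k)] =
    (\prod_(k < d) uniform_prob (@ltr01 R) (A k))%E.

Definition vertex_pair (n : nat) := {e : 'I_n * 'I_n | (e.1 < e.2)%N}.

Definition embedded_graph_sigma (dT : measure_display) (T : measurableType dT)
    (R : realType) (P : probability T R) (d n : nat)
    (X : 'I_n -> {RV P >-> d.-tuple R}) (G : 'I_n -> 'I_n -> {RV P >-> bool})
    (k : 'I_n + vertex_pair n) : set (set T) :=
  match k with
  | inl i => preimage_set_system setT (X i) measurable
  | inr e => preimage_set_system setT (G (val e).1 (val e).2) measurable
  end.

(* Each unordered pair of vertices is represented by the pair (i, j) with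
   i < j; the remaining values of G are fixed by symmetry and irreflexivity. *)
Record random_embedded_graph (dT : measure_display) (T : measurableType dT)
    (R : realType) (P : probability T R) (d n : nat) (p : R)
    (X : 'I_n -> {RV P >-> d.-tuple R})
    (G : 'I_n -> 'I_n -> {RV P >-> bool}) : Prop := RandomEmbeddedGraph {
  reg_sym : forall w, symmetric (fun i j => G i j w) ;
  reg_irrefl : forall w, irreflexive (fun i j => G i j w) ;
  reg_position : forall i, uniform_on_cube (X i) ;
  reg_edge : forall i j : 'I_n, (i < j)%N -> P [set w | G i j w] = p%:E ;
  reg_indep : mutually_independent P (embedded_graph_sigma X G)
}.

Definition random_dist (dT : measure_display) (T : measurableType dT)
    (R : realType) (P : probability T R) (d n : nat)
    (X : 'I_n -> {RV P >-> d.-tuple R}) (G : 'I_n -> 'I_n -> {RV P >-> bool})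
    (w : T) (u v : 'I_n) : \bar R :=
  graph_dist (fun i => X i w) (fun i j => G i j w) u v.

(* The first conjunct makes the second meaningful: a measure is unconstrained
   outside the measurable sets. *)
Definition asymptotically_almost_surely (R : realType)
    (dT : nat -> measure_display) (T : forall n, measurableType (dT n))
    (P : forall n, probability (T n) R) (E : forall n, set (T n)) : Prop :=
  (forall n, measurable (E n)) /\
  ((fun n => P n (~` E n)) @ \oo --> 0%E).

(* Main.v *)
Require Import Defs.
From HB Require Import structures.
From mathcomp Require Import all_boot all_order all_algebra.
From mathcomp Require Import all_classical all_reals all_analysis.
From mathcomp Require Import measurable_realfun ring lra zify.

Set Implicit Arguments.
Unset Strict Implicit.
Unset Printing Implicit Defensive.

Import Order.TTheory GRing.Theory Num.Theory.
Import numFieldTopology.Exports numFieldNormedType.Exports.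

Local Open Scope ring_scope.

(** Everything is transferred to a finite model.  Cut the cube into M^d equal
    cells and record the cell of every vertex: the cells are independent and
    uniform, the edges are independent Bernoulli(p), and the event of interest
    contains every sample whose cells and edges are good, so that the failure
    probability is at most a finite sum.

    (a) First moment with a Chernoff bound.  A path of k edges and length at
    most D is present with probability at most p^k e^(mu D) E[e^(-mu length)],
    and exposing the positions one by one gives E[e^(-mu length)] <= kappa^k
    with kappa = O(1/mu)^d.  There are at most n^(k-1) paths, so if
    n p kappa <= 1/2 then the sum over k is at most e^(mu D)/n.

    (b) Let 4^J <= n < 4^L, L = J + 1, and use two grids: coarse cells of side
    1/K, of constant size, and small cells of side 1/(K L).  With probability
    1 - e^(-6L), a vertex u has 6L neighbours in its coarse cell, because their
    expected number is of larger order than log n.  Then a breadth-first search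
    inside the small cells doubles J times: expected degrees there are of order
    omega, so a layer of s >= 6L vertices fails to find 2s new ones with
    probability at most e^(-s).  This yields 6L 2^J > sqrt n vertices within
    distance O(d/K) of u.  Two such sets, around u and around v, are joined by
    an edge with probability 1 - e^(-6L), which beats the union over the n^2
    pairs. *)

(** * Product expectations over finite functions *)

Definition upd (I : finType) (T : Type) (f : {ffun I -> T}) (i : I) (c : T) :
  {ffun I -> T} := [ffun j => if j == i then c else f j].

Section ProductExpectation.
Variables (R : realFieldType) (I T : finType) (w : T -> R).

(** When [w] is a probability, this is the expectation of [F] for independent coordinates of law
    [w]. *)
Definition EX (F : {ffun I -> T} -> R) : R :=
  \sum_(f : {ffun I -> T}) (\prod_i w (f i)) * F f.

Lemma eq_EX F G : F =1 G -> EX F = EX G.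
Proof. by move=> FG; apply: eq_bigr => f _; rewrite FG. Qed.

Lemma EX_sum (J : Type) (r : seq J) (P : pred J) (F : J -> {ffun I -> T} -> R) :
  EX (fun f => \sum_(j <- r | P j) F j f) = \sum_(j <- r | P j) EX (F j).
Proof.
by rewrite exchange_big/=; apply: eq_bigr => f _; rewrite mulr_sumr.
Qed.

Lemma EXD F G : EX (fun f => F f + G f) = EX F + EX G.
Proof. by rewrite -big_split; apply: eq_bigr => f _; rewrite mulrDr. Qed.

Lemma EXZ (c : R) F : EX (fun f => c * F f) = c * EX F.
Proof. by rewrite mulr_sumr; apply: eq_bigr => f _; rewrite mulrCA. Qed.

Lemma EX_prod (h : T -> R) :
  EX (fun f => \prod_i h (f i)) = (\sum_c w c * h c) ^+ #|I|.
Proof.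
rewrite -prodr_const (bigA_distr_bigA (fun _ c => w c * h c))/=.
by apply: eq_bigr => f _; rewrite big_split.
Qed.

Hypotheses (w_ge0 : forall c, 0 <= w c) (w_sum1 : \sum_c w c = 1).

Lemma le_EX F G : (forall f, F f <= G f) -> EX F <= EX G.
Proof.
by move=> FG; apply: ler_sum => f _; rewrite ler_wpM2l// prodr_ge0.
Qed.

Lemma EX_cst c : EX (fun=> c) = c.
Proof.
rewrite -[RHS]mulr1 -[c in LHS]mulr1 EXZ; congr (_ * _).
have := EX_prod (fun=> 1); rewrite (eq_EX (G := fun=> 1)) => [->|f].
  by under eq_bigr do rewrite mulr1; rewrite w_sum1 expr1n.
by rewrite big1.
Qed.

(* [(f, c) |-> (upd f i c, f i)] is an involution preserving the weight. *)
Lemma EX_resample (i : I) F :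
  EX F = EX (fun f => \sum_c w c * F (upd f i c)).
Proof.
rewrite [RHS]/EX.
under eq_bigr do rewrite mulr_sumr.
rewrite pair_big/=.
pose h (fc : {ffun I -> T} * T) := (upd fc.1 i fc.2, fc.1 i).
have hK : involutive h.
  move=> [f c]; rewrite /h/= ffunE eqxx; congr pair.
  by apply/ffunP => j; rewrite !ffunE; case: eqP => [->|].
rewrite (reindex_inj (inv_inj hK))/=.
transitivity (\sum_(fc : {ffun I -> T} * T)
    (\prod_j w (fc.1 j)) * (w fc.2 * F fc.1)).
  rewrite -(pair_big predT predT
    (fun (f : {ffun I -> T}) c => (\prod_j w (f j)) * (w c * F f)))/=.
  apply: eq_bigr => f _; rewrite -mulr_sumr -mulr_suml w_sum1 mul1r//.
apply: eq_bigr => -[f c] _ /=.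
rewrite !mulrA; congr (_ * _); last first.
  by congr F; apply/ffunP => j; rewrite !ffunE; case: eqP => [->|].
rewrite (bigD1 i)//= [in RHS](bigD1 i)//= ffunE eqxx [RHS]mulrAC mulrC mulrA.
by congr (_ * _); apply: eq_bigr => j /negPf ji; rewrite ffunE ji.
Qed.

End ProductExpectation.

(** * Independent edges, conditioned on those already exposed *)

Section Bernoulli.
Variables (R : realFieldType) (p : R) (E : finType).

Definition bern (b : bool) : R := if b then p else 1 - p.

Lemma bern_ge0 : 0 <= p <= 1 -> forall b, 0 <= bern b.
Proof. by case/andP=> p0 p1 [] //=; rewrite subr_ge0. Qed.

Lemma bern_sum1 : \sum_b bern b = 1.
Proof. by rewrite big_bool/= addrC subrK. Qed.

(* Partial information on the edges, [None] meaning not exposed yet; [cprob s]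
   is the conditional probability given the exposed edges. *)
Definition state := {ffun E -> option bool}.

Definition complete (s : state) (g : {ffun E -> bool}) : {ffun E -> bool} :=
  [ffun e => odflt (g e) (s e)].

Definition cprob (s : state) (Q : pred {ffun E -> bool}) : R :=
  EX bern (fun g => (Q (complete s g))%:R).

(** Total probability over one edge: resample [e] and split on its value. As [e] is unexposed,
    completing [s] by the resampled [g] amounts to completing the updated state by [g]. *)
Lemma cprob_reveal (s : state) Q e : s e = None ->
  cprob s Q = p * cprob (upd s e (Some true)) Q
            + (1 - p) * cprob (upd s e (Some false)) Q.
Proof.
move=> se; rewrite /cprob (EX_resample bern_sum1 e) -!EXZ.
under eq_EX do rewrite big_bool.
rewrite -big_split/=; apply: eq_bigr => g _; rewrite -mulrDr; congr (_ * _).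
congr (_ * (Q _)%:R + _ * (Q _)%:R).
all: by apply/ffunP => e'; rewrite !ffunE; case: eqP => // ->; rewrite se.
Qed.

Hypothesis p01 : 0 <= p <= 1.

Lemma cprob_le1 (s : state) Q : cprob s Q <= 1.
Proof.
rewrite -[leRHS](EX_cst E bern_sum1 1); apply: le_EX => [|f].
  exact: bern_ge0.
by case: (Q _); rewrite ?ler01.
Qed.

Lemma cprob_eq0 (s : state) Q : (forall g, ~~ Q (complete s g)) -> cprob s Q = 0.
Proof.
move=> Q0; rewrite -[RHS](EX_cst E bern_sum1 0); apply: eq_EX => g.
by rewrite (negPf (Q0 _)).
Qed.

End Bernoulli.

(** * Exposing edges one at a time *)

Section Exploration.
Variables (R : realFieldType) (p : R) (V E : finType) (ed : V -> V -> E).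
Hypothesis p01 : 0 <= p <= 1.
Hypothesis ed_inj : forall a b c d, a != b -> c != d -> ed a b = ed c d ->
  (a == c) && (b == d) || (a == d) && (b == c).

Definition linked (s : state E) (a b : V) :=
  (a != b) && (s (ed a b) == Some true).

(** [D] collects the processed vertices. Freshness is all that later rounds need to know of the
    past: edges between vertices outside [D] are still independent Bernoulli(p). *)
Definition fresh (s : state E) (D : {set V}) := forall a b,
  a \notin D -> b \notin D -> a != b -> s (ed a b) = None.

Lemma fresh_sub (s : state E) (D D' : {set V}) :
  D \subset D' -> fresh s D -> fresh s D'.
Proof.
move=> DD' sD a b aD bD; apply: sD.
- by apply: contra aD; exact: (fintype.subsetP DD').
- by apply: contra bD; exact: (fintype.subsetP DD').
Qed.

Lemma fresh_upd (s : state E) (D : {set V}) a b v : a \in D -> a != b ->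
  fresh s D -> fresh (upd s (ed a b) v) D.
Proof.
move=> aD ab sD c d cD dD cd; rewrite ffunE; case: eqP => [cab|_]; last exact: sD.
have /orP[|] := ed_inj cd ab cab => /andP[/eqP ? /eqP ?]; subst.
- by rewrite aD in cD.
- by rewrite aD in dD.
Qed.

Section Layer.
(** [Q] is the failure event, [A0] the layer being processed, [C a] the candidates examined from
    [a], and [B] the vertices found, of which [t] are wanted. Candidates avoid [D1], which contains
    the layer, so that no edge is examined twice. *)
Variables (Q : pred {ffun E -> bool}) (x : R) (t : nat).
Variables (C : V -> {set V}) (A0 D1 : {set V}).
Variable Inv : state E -> {set V} -> Prop.
Hypothesis x_ge0 : 0 <= x.
Hypothesis A0D1 : A0 \subset D1.
Hypothesis CD1 : forall a, a \in A0 -> [disjoint C a & D1].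
Hypothesis stop : forall s B,
  Inv s B -> fresh s D1 -> #|B| = t -> cprob p s Q <= x.
Hypothesis Inv_absent : forall (s : state E) B a b,
  a \in A0 -> b \in C a -> s (ed a b) = None ->
  Inv s B -> Inv (upd s (ed a b) (Some false)) B.
Hypothesis Inv_present : forall (s : state E) B a b,
  a \in A0 -> b \in C a -> s (ed a b) = None ->
  Inv s B -> Inv (upd s (ed a b) (Some true)) (b |: B).

(* Each exposure either adds a vertex to [B] or not, and
   [p / 2 + (1 - p) = 1 - p / 2]: so [2 ^+ t / 2 ^+ #|B|] times [1 - p / 2] to
   the number of exposures still to come is a martingale.  It bounds the
   probability that the layer ends with [#|B| < t]; once [#|B| = t] the
   hypothesis [stop] takes over. *)
Lemma explore_vertex (a : V) (D : {set V}) (y : R) (L : seq V)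
    (s : state E) (B : {set V}) :
  a \in A0 -> a |: D \subset D1 -> 0 <= y ->
  (forall s B, Inv s B -> fresh s (a |: D) -> (#|B| < t)%N ->
     cprob p s Q <= x + 2 ^+ t / 2 ^+ #|B| * y) ->
  uniq L -> {subset L <= C a} ->
  fresh s (a |: D) -> (forall b, b \in L -> s (ed a b) = None) ->
  Inv s B -> (#|B| <= t)%N ->
  cprob p s Q <=
    x + 2 ^+ t / 2 ^+ #|B| * ((1 - p / 2) ^+ count [predC B] L * y).
Proof.
move=> aA0 aDD1 y0 next.
have rho0 : 0 <= 1 - p / 2 by move/andP: p01; lra.
have pow0 (k : nat) : 0 <= 2 ^+ t / 2 ^+ k :> R.
  by rewrite divr_ge0// exprn_ge0.
elim: L s B => [|b L IH] s B /=.
  move=> _ _ sD _ sB; rewrite leq_eqVlt => /orP[/eqP Bt|Bt].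
    rewrite (le_trans (stop sB (fresh_sub aDD1 sD) Bt))// lerDl.
    by rewrite mulr_ge0// mulr_ge0// exprn_ge0.
  by rewrite expr0 mul1r; exact: next.
move=> /andP[bL uL] bLC sD sL sB Bt.
have bC : b \in C a by apply: bLC; rewrite inE eqxx.
have LC : {subset L <= C a} by move=> c cL; apply: bLC; rewrite inE cL orbT.
have sL' c : c \in L -> s (ed a c) = None.
  by move=> cL; apply: sL; rewrite inE cL orbT.
(* A vertex already found is not queried again; hence only candidates outside [B] contribute to the
   exponent. *)
case: (boolP (b \in B)) => bB /=; first exact: IH.
move: Bt; rewrite leq_eqVlt => /orP[/eqP Bt|Bt].
  rewrite (le_trans (stop sB (fresh_sub aDD1 sD) Bt))// lerDl.
  by rewrite mulr_ge0// mulr_ge0// exprn_ge0.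
have sab : s (ed a b) = None by apply: sL; rewrite inE eqxx.
have aC c : c \in C a -> a != c.
  move=> cC; apply/eqP => ac; move: cC; rewrite -ac => aC.
  have := disjointFr (CD1 aA0) aC.
  by rewrite (fintype.subsetP A0D1).
have sL2 v c : c \in L -> upd s (ed a b) v (ed a c) = None.
  move=> cL; rewrite ffunE; case: eqP => [e|_]; last exact: sL'.
  have /orP[|] := ed_inj (aC _ (LC _ cL)) (aC _ bC) e.
    by move=> /andP[_ /eqP cb]; rewrite -cb cL in bL.
  by move=> /andP[/eqP ab _]; have := aC _ bC; rewrite ab eqxx.
have ext v : fresh (upd s (ed a b) v) (a |: D).
  by apply: fresh_upd => //; [rewrite !inE eqxx | exact: aC].
have H1 := IH _ _ uL LC (ext (Some true)) (sL2 _) (Inv_present aA0 bC sab sB).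
have H0 := IH _ _ uL LC (ext (Some false)) (sL2 _) (Inv_absent aA0 bC sab sB) (ltnW Bt).
rewrite cardsU1 bB /= add1n in H1.
have cnt : count [predC b |: B] L = count [predC B] L.
  apply: eq_in_count => c cL; rewrite !inE; case: eqP => // cb.
  by rewrite -cb cL in bL.
move: (H1 Bt); rewrite cnt => {}H1.
rewrite (cprob_reveal p Q sab) exprD expr1.
set z := _ * y in H0 H1.
have e2 : 2 ^+ t / 2 ^+ #|B|.+1 = 2 ^+ t / 2 ^+ #|B| / 2 :> R.
  by rewrite exprSr invfM mulrA.
rewrite e2 in H1.
set q := 2 ^+ t / 2 ^+ #|B| in H0 H1 *.
have [p0 p1] := andP p01.
have -> : x + q * ((1 - p / 2) * (1 - p / 2) ^+ count [predC B] L * y) =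
  p * (x + q / 2 * z) + (1 - p) * (x + q * z) by rewrite -mulrA -/z; lra.
by apply: lerD; apply: ler_wpM2l => //; rewrite subr_ge0.
Qed.

(** Induction on the layer, each processed vertex moving into [D]. As long as fewer than [t]
    vertices are found, at least [m] of the [m + t] candidates of the next vertex are new, so it
    contributes a factor [(1 - p / 2) ^+ m]. *)
Lemma explore_layer (m : nat) (A : seq V) (D : {set V}) (s : state E)
    (B : {set V}) :
  uniq A -> {subset A <= A0} -> (forall a, a \in A -> a \notin D) ->
  D \subset D1 -> (forall a, a \in A0 -> (m + t <= #|C a|)%N) ->
  fresh s D -> Inv s B -> (#|B| <= t)%N ->
  cprob p s Q <= x + 2 ^+ t / 2 ^+ #|B| * ((1 - p / 2) ^+ m) ^+ size A.
Proof.
move=> + + + + mC.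
have [p0 p1] := andP p01.
have rho0 : 0 <= 1 - p / 2 by lra.
elim: A D s B => [|a A IH] D s B /=.
  move=> _ _ _ DD1 sD sB; rewrite leq_eqVlt => /orP[/eqP Bt|Bt].
    rewrite (le_trans (stop sB (fresh_sub DD1 sD) Bt))// lerDl.
    by rewrite expr0 mulr1 divr_ge0// exprn_ge0.
  (* The layer ended too early: the trivial bound 1 is below [2 ^+ t / 2 ^+ #|B|]. *)
  rewrite (le_trans (cprob_le1 p01 _ _))// expr0 mulr1.
  rewrite (@le_trans _ _ (2 ^+ t / 2 ^+ #|B|))// ?lerDr//.
  by rewrite ler_pdivlMr ?exprn_gt0// mul1r ler_eXn2l ?ltr1n// ltnW.
move=> /andP[aA uA] AA0 AD DD1 sD sB Bt.
have aA0 : a \in A0 by apply: AA0; rewrite inE eqxx.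
have aD : a \notin D by apply: AD; rewrite inE eqxx.
have aDD1 : a |: D \subset D1.
  by rewrite finset.subUset DD1 andbT finset.sub1set (fintype.subsetP A0D1).
have Ca b : b \in C a -> b \notin D1 by move=> /(disjointFr (CD1 aA0)) ->.
have y0 : 0 <= ((1 - p / 2) ^+ m) ^+ size A by rewrite !exprn_ge0.
have := @explore_vertex a D _ (enum (C a)) s B aA0 aDD1 y0.
move=> /(_ _ (enum_uniq _) _ _ _ sB Bt) H.
apply: (le_trans (H _ _ _ _)).
- move=> s' B' sB' sD' Bt'; apply: (IH (a |: D)) => //.
  + by move=> b bA; apply: AA0; rewrite inE bA orbT.
  + move=> b bA; rewrite !inE negb_or (AD b) ?inE ?bA ?orbT// andbT.
    by apply: contraNneq aA => <-.
  + exact: ltnW.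
- by move=> b; rewrite mem_enum.
- by apply: fresh_sub sD; rewrite finset.subsetUr.
- move=> b; rewrite mem_enum => bC; apply: sD => //.
  + by apply: contra (Ca _ bC); exact: (fintype.subsetP DD1).
  + apply: contraNneq (Ca _ bC) => <-; exact: (fintype.subsetP A0D1).
- rewrite lerD2l ler_wpM2l ?divr_ge0 ?exprn_ge0// exprS ler_wpM2r//.
  rewrite ler_wiXn2l//; first by lra.
  rewrite -size_filter; have := mC _ aA0.
  have -> : size [seq i <- enum (C a) | [predC B] i] = #|C a :\: B|.
    rewrite cardE; apply: perm_size; apply: uniq_perm.
    - by rewrite filter_uniq// enum_uniq.
    - exact: enum_uniq.
    - by move=> b; rewrite mem_filter !mem_enum !inE.
  have := cardsID B (C a).
  have := subset_leq_card (finset.subsetIr (C a) B).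
  by move: Bt; clear; lia.
Qed.

End Layer.
End Exploration.

(** * Breadth-first search and the joining of two vertices *)

Section Connecting.
Variables (R : realFieldType) (p : R) (V E : finType) (ed : V -> V -> E).
Hypothesis p01 : 0 <= p <= 1.
Hypothesis ed_inj : forall a b c d, a != b -> c != d -> ed a b = ed c d ->
  (a == c) && (b == d) || (a == d) && (b == c).

Definition extends (s s' : state E) := forall e b, s e = Some b -> s' e = Some b.

Lemma extends_trans s1 s2 s3 : extends s1 s2 -> extends s2 s3 -> extends s1 s3.
Proof. by move=> s12 s23 e b /s12 /s23. Qed.

Lemma extends_upd (s : state E) e b : s e = None -> extends s (upd s e (Some b)).
Proof. by move=> se e' b' se'; rewrite ffunE; case: eqP se' => // ->; rewrite se. Qed.

Lemma linked_extends s s' : extends s s' -> subrel (linked ed s) (linked ed s').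
Proof. by move=> ss' a b /andP[ab /eqP /ss' e]; rewrite /linked ab e eqxx. Qed.

(** The layer bound started with nothing found. The invariant keeps, for every vertex found, one
    present edge back to the layer [S]. *)
Lemma explore_links (Q : pred {ffun E -> bool}) (x : R) (t m : nat)
    (C : V -> {set V}) (S D : {set V}) (s : state E) :
  0 <= x -> (forall a, a \in S -> [disjoint C a & D :|: S]) ->
  (forall a, a \in S -> (m + t <= #|C a|)%N) ->
  fresh ed s D -> [disjoint S & D] ->
  (forall s' (B : {set V}), extends s s' -> fresh ed s' (D :|: S) -> #|B| = t ->
    (forall b, b \in B -> exists2 a, a \in S & (b \in C a) && linked ed s' a b) ->
    cprob p s' Q <= x) ->
  cprob p s Q <= x + 2 ^+ t * ((1 - p / 2) ^+ m) ^+ #|S|.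
Proof.
move=> x0 CD mC sD SD stop.
pose Inv (s' : state E) (B : {set V}) := extends s s' /\
  forall b, b \in B -> exists2 a, a \in S & (b \in C a) && linked ed s' a b.
have sub := finset.subsetUr D S.
(* Present and absent edges share this argument; the disjunct [v = None] disposes of the value that
   is never written. *)
have step (s' : state E) (B : {set V}) a b v : s' (ed a b) = None -> Inv s' B ->
    Inv (upd s' (ed a b) v) B \/ v = None.
  case: v => [v|]; last by right.
  move=> se [ss' B']; left; split; first exact: extends_trans (extends_upd _ se).
  move=> c /B'[a' a'S /andP[ca' l]]; exists a'; rewrite // ca'.
  exact: linked_extends (extends_upd _ se) _ _ l.
have := @explore_layer _ p V E ed p01 ed_inj Q x t C S (D :|: S) Inv x0 sub CD.
move=> /(_ _ _ _ m (enum S) D s finset.set0).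
rewrite cards0 expr0 divr1 -cardE; apply => //.
- by move=> s' B [ss' B'] sD' Bt; exact: (stop s' B).
- by move=> s' B a b aS bC se /(step s' B a b (Some false) se)[].
- move=> s' B a b aS bC se sB.
  have [[ss' B']|//] := step s' B a b (Some true) se sB.
  split=> // c; rewrite !inE => /orP[/eqP ->|/B'//].
  exists a => //; rewrite bC /linked ffunE eqxx /= andbT.
  apply: contraTneq bC => <-; apply/negP => /(disjointFr (CD _ aS)).
  by rewrite inE aS orbT.
- exact: enum_uniq.
- by move=> a; rewrite mem_enum.
- by move=> a; rewrite mem_enum => /(disjointFr SD) ->.
- exact: finset.subsetUl.
- by split => [//|b]; rewrite inE.
Qed.

Variables (Co Sm : eqType) (co : V -> Co) (sm : V -> Sm).

(** The first edge stays in the coarse cell of [u], each of the [k] others in a small cell, which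
    controls the length. The cells are abstract labels because the search uses only the sizes of
    their classes. *)
Fixpoint near (e : rel V) (u : V) (k : nat) (a : V) : bool :=
  if k is k'.+1 then [exists b, [&& near e u k' b, sm b == sm a & e b a]]
  else (co u == co a) && e u a.

Lemma near_subrel e e' u k a : subrel e e' -> near e u k a -> near e' u k a.
Proof.
move=> ee'; elim: k a => [|k IH] a /=; first by move=> /andP[-> /ee'].
by move=> /existsP[b /and3P[/IH ub ba /ee' eba]]; apply/existsP; exists b;
  rewrite ub ba.
Qed.

(* The search from [u] after [j] rounds in small cells, begun with information
   [sI]: [D] are the vertices already explored, [S] the current layer, and [Y]
   the vertices to be avoided, which were [Y0] at the start. *)
Record frontier (sI : state E) (Y0 D0 : {set V}) (u : V) (j : nat)
    (s : state E) (D S Y : {set V}) : Prop := Frontier {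
  fr_ext : extends sI s ;
  fr_fresh : fresh ed s D ;
  fr_SD : [disjoint S & D] ;
  fr_Y : D :|: S \subset Y ;
  fr_Y0 : Y0 \subset Y ;
  fr_S0 : [disjoint S & Y0] ;
  fr_D0 : D :&: Y0 \subset D0 ;
  fr_near : forall b, b \in S -> near (linked ed s) u j b
}.

(** The first layer has [s0] vertices and doubles [J] times; [zmax] bounds the vertices to avoid.
    [M0] and [M1] bound from below the occupancy of small and coarse cells, [m0] and [m1] what
    remains after removing the avoided vertices and the target. One round fails with probability at
    most [y]. *)
Variables (Q : pred {ffun E -> bool}) (x y : R) (s0 m m0 m1 M0 M1 J zmax : nat).
Hypotheses (x_ge0 : 0 <= x) (y_ge0 : 0 <= y).
Hypothesis small_cells : forall a, (M0 <= #|[set b | sm b == sm a]|)%N.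
Hypothesis coarse_cells : forall a, (M1 <= #|[set b | co b == co a]|)%N.
Hypothesis m0P : (m0 + 2 * (s0 * 2 ^ J) + zmax <= M0)%N.
Hypothesis m1P : (m1 + s0 + zmax <= M1)%N.
Hypothesis y_layer : forall i, (4 * (1 - p / 2) ^+ m0) ^+ (s0 * 2 ^ i) <= y.
Hypothesis y_first : 2 ^+ s0 * (1 - p / 2) ^+ m1 <= y.

Lemma card_avoid (B Y : {set V}) k : (k + zmax <= #|B|)%N -> (#|Y| <= zmax)%N ->
  (k <= #|B :\: Y|)%N.
Proof.
move=> kB Yz; rewrite cardsD leq_subRL; last first.
  exact: subset_leq_card (finset.subsetIl _ _).
rewrite (leq_trans _ kB)// addnC leq_add2l (leq_trans _ Yz)//.
exact: subset_leq_card (finset.subsetIr _ _).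
Qed.

(** Each of the [k] rounds asks the layer for twice its size in new vertices. Together they find s0
    (2^(j+k+1) - 2^(j+1)) vertices, and the budget on [#|Y|] leaves room for exactly these within
    [z]. *)
Lemma grow (z : nat) sI Y0 D0 u k j s D S Y : (z <= zmax)%N -> (j + k <= J)%N ->
  frontier sI Y0 D0 u j s D S Y -> #|S| = (s0 * 2 ^ j)%N ->
  (#|Y| + s0 * 2 ^ (j + k).+1 <= z + s0 * 2 ^ j.+1)%N ->
  (forall s' D' S' Y', frontier sI Y0 D0 u (j + k) s' D' S' Y' ->
    #|S'| = (s0 * 2 ^ (j + k))%N -> (#|Y'| <= z)%N -> cprob p s' Q <= x) ->
  cprob p s Q <= x + k%:R * y.
Proof.
move=> zz; elim: k j s D S Y => [|k IH] j s D S Y jJ fr cS cY cont.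
  rewrite mul0r addr0; rewrite addn0 in cY cont; apply: (cont s D S Y) => //.
  by move: cY; rewrite leq_add2r.
have -> : k.+1%:R * y = k%:R * y + y by rewrite -addn1 natrD mulrDl mul1r.
have pk : (s0 * 2 ^ j.+1 <= s0 * 2 ^ (j + k.+1).+1)%N.
  by rewrite leq_mul2l leq_exp2l// ltnS leq_addr orbT.
have pJ : (s0 * 2 ^ j <= s0 * 2 ^ J)%N.
  by rewrite leq_mul2l leq_exp2l// (leq_trans (leq_addr k.+1 j) jJ) orbT.
have Yz : (#|Y| <= zmax)%N by move: cY pk zz; clear; lia.
pose C a := [set b | sm b == sm a] :\: Y.
have CY a b : b \in C a -> b \notin Y by rewrite inE => /andP[].
have CDS a : [disjoint C a & D :|: S].
  rewrite disjoint_subset; apply/fintype.subsetP => b /CY; apply: contra.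
  exact: (fintype.subsetP (fr_Y fr)).
have mC a : (m0 + #|S| * 2 <= #|C a|)%N.
  apply: card_avoid => //; rewrite (leq_trans _ (small_cells a))//.
  by rewrite cS; move: m0P pJ; clear; lia.
have xk : 0 <= x + k%:R * y by rewrite addr_ge0// mulr_ge0.
have := @explore_links Q _ (#|S| * 2) m0 C S D s xk (fun a _ => CDS a)
  (fun a _ => mC a) (fr_fresh fr) (fr_SD fr).
move=> H; apply: le_trans (H _) _; last first.
  (* The target [2 #|S|] gives the factor [4 ^+ #|S|], which merges with the other power. *)
  rewrite addrA lerD2l mulnC exprM -exprMn -natrX cS.
  exact: y_layer.
move=> s' B ss' sD' cB B'.
apply: (IH j.+1 s' (D :|: S) B (Y :|: B)).
- by rewrite addSnnS.
- have BY : [disjoint B & Y].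
    rewrite disjoint_subset; apply/fintype.subsetP => b /B'[a _ /andP[/CY]].
    by [].
  have DSY := fr_Y fr.
  split=> //.
  + exact: extends_trans (fr_ext fr) ss'.
  + exact: disjointWr BY.
  + exact: finset.setSU.
  + by rewrite (fintype.subset_trans (fr_Y0 fr))// finset.subsetUl.
  + exact: disjointWr (fr_Y0 fr) BY.
  + rewrite finset.setIUl finset.subUset (fr_D0 fr)/=.
    by move: (fr_S0 fr); rewrite -setI_eq0 => /eqP ->; rewrite finset.sub0set.
  + move=> b /B'[a aS /andP[bC l]]; apply/existsP; exists a; apply/and3P; split=> //.
      exact: near_subrel (linked_extends ss') (fr_near fr aS).
    by move: bC; rewrite !inE eq_sym => /andP[].
- by rewrite cB cS expnS mulnCA mulnC.
- rewrite addSnnS; have := (leq_card_setU Y B).1.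
  rewrite cB cS; move: cY; rewrite addnS !expnS; move: (2 ^ _)%N => q.
  by move: (2 ^ _)%N => r; clear; lia.
- by rewrite addSnnS.
Qed.

(** One round in the coarse cell of [u] finds [s0] vertices, then [grow] doubles them [J] times. All
    layers together have fewer than s0 2^(J+1) vertices. *)
Lemma explore (z : nat) (s : state E) (Y0 D : {set V}) (u : V) :
  (z <= zmax)%N -> (#|Y0| + s0 * 2 ^ J.+1 <= z)%N ->
  fresh ed s D -> u \notin D -> u \in Y0 -> D \subset Y0 ->
  (forall s' D' S' Y', frontier s Y0 (u |: D) u J s' D' S' Y' ->
    #|S'| = (s0 * 2 ^ J)%N -> (#|Y'| <= z)%N -> cprob p s' Q <= x) ->
  cprob p s Q <= x + J.+1%:R * y.
Proof.
move=> zz cY sD uD uY DY cont.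
have -> : J.+1%:R * y = J%:R * y + y by rewrite -addn1 natrD mulrDl mul1r.
pose C a := [set b | co b == co a] :\: Y0.
have CDS a : a \in [set u] -> [disjoint C a & D :|: [set u]].
  move=> _; rewrite disjoint_subset; apply/fintype.subsetP => b.
  rewrite inE => /andP[bY _]; apply: contra bY; apply: (fintype.subsetP _).
  by rewrite finset.subUset DY finset.sub1set.
have mC a : a \in [set u] -> (m1 + s0 <= #|C a|)%N.
  move=> _; apply: card_avoid; first exact: leq_trans m1P (coarse_cells a).
  by rewrite (leq_trans _ zz)// (leq_trans _ cY)// leq_addr.
have xJ : 0 <= x + J%:R * y by rewrite addr_ge0// mulr_ge0.
have uD' : [disjoint [set u] & D] by rewrite disjoints1.
have := @explore_links Q _ s0 m1 C [set u] D s xJ CDS mC sD uD'.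
rewrite cards1 expr1 => H; apply: le_trans (H _) _; last by rewrite addrA lerD2l.
move=> s' B ss' sD' cB B'.
have BY : [disjoint B & Y0].
  rewrite disjoint_subset; apply/fintype.subsetP => b /B'[a _ /andP[]].
  by rewrite !inE => /andP[].
have uDY : D :|: [set u] \subset Y0 by rewrite finset.subUset DY finset.sub1set.
apply: (@grow z s Y0 (u |: D) u J 0 s' (D :|: [set u]) B (Y0 :|: B)) => //.
- split=> //.
  + exact: disjointWr BY.
  + exact: finset.setSU.
  + exact: finset.subsetUl.
  + by rewrite finset.setUC finset.subsetIl.
  + move=> b /B'[a]; rewrite inE => /eqP -> /andP[bC /= ->].
    by move: bC; rewrite !inE eq_sym andbT => /andP[].
- by rewrite expn0 muln1.
- rewrite add0n expn1; have := (leq_card_setU Y0 B).1.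
  by move: cY; rewrite cB; clear; lia.
Qed.

End Connecting.

Section ConnectingPair.
Variables (R : realFieldType) (p : R) (V E : finType) (ed : V -> V -> E).
Hypothesis p01 : 0 <= p <= 1.
Hypothesis ed_inj : forall a b c d, a != b -> c != d -> ed a b = ed c d ->
  (a == c) && (b == d) || (a == d) && (b == c).
Variables (Co Sm : eqType) (co : V -> Co) (sm : V -> Sm).

Definition adjacent (g : {ffun E -> bool}) (a b : V) := (a != b) && g (ed a b).

Definition joined (J : nat) (g : {ffun E -> bool}) (u v : V) :=
  [exists a, exists b, [&& near co sm (adjacent g) u J a,
    near co sm (adjacent g) v J b & adjacent g a b]].

Lemma linked_complete (s : state E) g :
  subrel (linked ed s) (adjacent (complete s g)).
Proof. by move=> a b /andP[ab /eqP sab]; rewrite /adjacent ab ffunE sab. Qed.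

(** Two successive searches. The first avoids [v], which is thus unprocessed when the second starts;
    the second avoids all that the first has met. The edges between the two last layers are then
    unexposed and are examined in one more round, which makes 2 (J + 1) + 1 rounds in all. *)
Lemma prob_not_joined (y : R) (s0 m0 m1 M0 M1 J : nat) (u v : V) :
  0 <= y ->
  (forall a, (M0 <= #|[set b | sm b == sm a]|)%N) ->
  (forall a, (M1 <= #|[set b | co b == co a]|)%N) ->
  (m0 + 2 * (s0 * 2 ^ J) + (2 + 2 * (s0 * 2 ^ J.+1)) <= M0)%N ->
  (m1 + s0 + (2 + 2 * (s0 * 2 ^ J.+1)) <= M1)%N ->
  (forall i, (4 * (1 - p / 2) ^+ m0) ^+ (s0 * 2 ^ i) <= y) ->
  2 ^+ s0 * (1 - p / 2) ^+ m1 <= y ->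
  2 * ((1 - p / 2) ^+ (s0 * 2 ^ J).-1) ^+ (s0 * 2 ^ J) <= y ->
  u != v -> (0 < s0)%N ->
  EX (bern p) (fun g => (~~ joined J g u v)%:R) <= (2 * J.+1).+1%:R * y.
Proof.
move=> y0 smc coc m0P m1P ylayer yfirst ylast uv s0_gt0.
set T := (s0 * 2 ^ J)%N in m0P m1P ylast *.
have T0 : (0 < T)%N by rewrite muln_gt0 s0_gt0 expn_gt0.
have eT : (s0 * 2 ^ J.+1)%N = (2 * T)%N by rewrite expnS mulnCA.
pose Q g := ~~ joined J g u v.
pose s_ : state E := [ffun=> None].
have -> : EX (bern p) (fun g => (~~ joined J g u v)%:R) = cprob p s_ Q.
  apply: eq_EX => g; congr (~~ joined _ _ _ _)%:R.
  by apply/ffunP => e; rewrite !ffunE.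
have -> : (2 * J.+1).+1%:R * y = y + J.+1%:R * y + J.+1%:R * y.
  by rewrite -addn1 mul2n -addnn !natrD !mulrDl mul1r addrC addrA.
have yJ : 0 <= y + J.+1%:R * y by rewrite addr_ge0// mulr_ge0.
pose Y0 : {set V} := [set u; v].
have z1 : (#|Y0| + s0 * 2 ^ J.+1 <= 2 + s0 * 2 ^ J.+1)%N.
  by rewrite cards2 leq_add2r; case: eqP.
have zz1 : (2 + s0 * 2 ^ J.+1 <= 2 + 2 * (s0 * 2 ^ J.+1))%N.
  by rewrite leq_add2l leq_pmull.
have fresh0 : fresh ed s_ finset.set0 by move=> a b _ _ _; rewrite ffunE.
apply: (explore (u := u) p01 ed_inj yJ y0 smc coc m0P m1P ylayer yfirst zz1 z1 fresh0).
- by rewrite inE.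
- by rewrite !inE eqxx.
- exact: finset.sub0set.
move=> s1 D1 S1 Y1 fr1 cS1 cY1.
have z2 : (#|Y1| + s0 * 2 ^ J.+1 <= 2 + 2 * (s0 * 2 ^ J.+1))%N.
  by move: cY1; clear; lia.
have vD1 : v \notin D1.
  apply/negP => vD1; have /fintype.subsetP/(_ v) := fr_D0 fr1.
  by rewrite !inE vD1 eqxx orbT eq_sym (negPf uv) => /(_ isT).
have vY1 : v \in Y1 by rewrite (fintype.subsetP (fr_Y0 fr1))// !inE eqxx orbT.
have [D1Y1 S1Y1] : D1 \subset Y1 /\ S1 \subset Y1.
  by have := fr_Y fr1; rewrite finset.subUset => /andP.
apply: (explore p01 ed_inj y0 y0 smc coc m0P m1P ylayer yfirst (leqnn _) z2
  (fr_fresh fr1) vD1 vY1 D1Y1).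
move=> s2 D2 S2 Y2 fr2 cS2 cY2.
(* Among the vertices it must avoid, the second search processes only [v] and those of [D1]; [S1]
   meets neither. *)
have S1D2 : [disjoint S1 & D2].
  rewrite disjoint_subset; apply/fintype.subsetP => a aS1; apply/negP => aD2.
  have /fintype.subsetP/(_ a) := fr_D0 fr2.
  rewrite !inE aD2 (fintype.subsetP S1Y1 _ aS1) => /(_ isT)/orP[/eqP av|aD1].
    by move: (disjointFr (fr_S0 fr1) aS1); rewrite av in_set2 eqxx orbT.
  by have := disjointFr (fr_SD fr1) aS1; rewrite aD1.
have S2S1 : [disjoint S2 & S1] := disjointWr S1Y1 (fr_S0 fr2).
have S2C a : a \in S1 -> [disjoint S2 & D2 :|: S1].
  move=> _; rewrite disjoint_subset; apply/fintype.subsetP => b bS2.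
  by rewrite !inE (disjointFr (fr_SD fr2) bS2) (disjointFr S2S1 bS2).
have mS2 a : a \in S1 -> (T.-1 + 1 <= #|S2|)%N.
  by move=> _; rewrite addn1 prednK// cS2.
(* A single discovery suffices: afterwards [Q] is impossible, hence the bound 0 for the
   continuation. This target takes one of the [T] candidates, hence [T.-1]. *)
have := @explore_links _ p V E ed p01 ed_inj Q 0 1 T.-1 (fun=> S2) S1 D2 s2
  (lexx 0) S2C mS2 (fr_fresh fr2) S1D2.
rewrite cS1 -/T expr1 add0r => H; apply: le_trans (H _) ylast.
move=> s3 B s23 _ /eqP/cards1P[b ->] /(_ b (set11 b))[a aS1 /andP[bS2 l]].
rewrite cprob_eq0// => g; rewrite negbK.
apply/existsP; exists a; apply/existsP; exists b; apply/and3P; split.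
- have := fr_near fr1 aS1; apply: near_subrel => c d cd.
  apply: linked_complete; apply: linked_extends cd.
  exact: extends_trans (fr_ext fr2) s23.
- have := fr_near fr2 bS2; apply: near_subrel => c d cd.
  by apply: linked_complete; apply: linked_extends cd.
- exact: linked_complete l.
Qed.

End ConnectingPair.

(** * First moment over short paths *)

Section FirstMoment.
Variables (R : realFieldType) (p : R) (V E T : finType) (ed : V -> V -> E).
Hypothesis p01 : 0 <= p <= 1.
Hypothesis ed_inj : forall a b c d, a != b -> c != d -> ed a b = ed c d ->
  (a == c) && (b == d) || (a == d) && (b == c).

(** Resample the first edge: as [u] does not recur, the rest of the path never uses it. *)
Lemma prob_path (u : V) (s : seq V) : uniq (u :: s) ->
  EX (bern p) (fun g => (path (adjacent ed g) u s)%:R) = p ^+ size s.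
Proof.
elim: s u => [|a s IH] u; first by rewrite EX_cst//; exact: bern_sum1.
rewrite cons_uniq => /andP[uas uas'] /=.
have ua : u != a by apply: contraNneq uas => ->; rewrite inE eqxx.
rewrite exprS -(IH a uas') -EXZ (EX_resample (bern_sum1 p) (ed u a)).
apply: eq_EX => g; rewrite big_bool/= /adjacent ua !ffunE eqxx/= mulr0 addr0.
congr (_ * _%:R); congr nat_of_bool.
apply: (@eq_in_path _ (mem (a :: s))); last by apply/allP.
move=> c d cs ds; rewrite ffunE; case: (eqVneq c d) => //= cd.
case: eqP => // /(ed_inj cd ua) /orP[] /andP[/eqP ? /eqP ?]; subst.
- by rewrite cs in uas.
- by rewrite ds in uas.
Qed.

(** [h c c'] will dominate e^(-mu distance) for points of the cells [c] and [c']; [kappa] bounds its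
    mean over one end, uniformly in the other. *)
Variables (w : T -> R) (h : T -> T -> R) (kappa : R).
Hypotheses (w_ge0 : forall c, 0 <= w c) (w_sum1 : \sum_c w c = 1).
Hypothesis h_ge0 : forall c c', 0 <= h c c'.
Hypothesis h_mean : forall c', \sum_c w c * h c c' <= kappa.

Fixpoint chain (f : {ffun V -> T}) (u : V) (s : seq V) : R :=
  if s is a :: s' then h (f u) (f a) * chain f a s' else 1.

Lemma chain_ge0 f u s : 0 <= chain f u s.
Proof. by elim: s u => [|a s IH] u //=; rewrite mulr_ge0. Qed.

Lemma kappa_ge0 : 0 <= kappa.
Proof.
have [c _|noT] := pickP T.
  by apply: le_trans (h_mean c); apply: sumr_ge0 => c' _; rewrite mulr_ge0.
exfalso; have : \sum_c w c = 0 by rewrite big1// => c; have := noT c.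
by rewrite w_sum1 => /eqP; rewrite oner_eq0.
Qed.

(** The cell of the first vertex enters only the first factor, whose mean over that cell is at most
    [kappa] whatever the next cell is. *)
Lemma EX_chain (u : V) (s : seq V) : uniq (u :: s) ->
  EX w (fun f => chain f u s) <= kappa ^+ size s.
Proof.
elim: s u => [|a s IH] u; first by rewrite /= EX_cst.
rewrite cons_uniq => /andP[uas uas'].
rewrite (EX_resample w_sum1 u) /= exprS.
have chain_upd f c : chain (upd f u c) a s = chain f a s.
  elim: s a {IH uas'} uas => [//|b s IH] a uas /=.
  move: uas; rewrite !inE !negb_or => /and3P[ua ub us].
  by rewrite IH ?inE ?negb_or ?ub// !ffunE eq_sym (negPf ua) eq_sym (negPf ub).
have ua : a != u by apply: contraNneq uas => ->; rewrite inE eqxx.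
apply: (@le_trans _ _ (EX w (fun f => kappa * chain f a s))).
  apply: le_EX => // f.
  under eq_bigr => c _.
    rewrite chain_upd !ffunE eqxx (negPf ua) mulrA; over.
  by rewrite -mulr_suml ler_wpM2r// chain_ge0.
by rewrite EXZ ler_wpM2l ?IH// kappa_ge0.
Qed.

(* Chernoff's bound: [B * chain f u s] stands for e^(mu (D - length)). *)
Lemma first_moment (B : R) (Bad : {ffun V -> T} -> {ffun E -> bool} -> bool)
    (u v : V) :
  0 <= B -> #|V|%:R * (p * kappa) <= 2^-1 ->
  (forall f g, Bad f g -> exists t : seq V, [/\ uniq (u :: rcons t v),
     path (adjacent ed g) u (rcons t v) & 1 <= B * chain f u (rcons t v)]) ->
  EX w (fun f => EX (bern p) (fun g => (Bad f g)%:R)) <= B / #|V|%:R.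
Proof.
move=> B0 npk badP.
have [p0 p1] := andP p01.
have V0 : (0 < #|V|)%N by apply/card_gt0P; exists u.
have k0 := kappa_ge0.
pose F k (t : k.-tuple V) f (g : {ffun E -> bool}) : R :=
  B * (chain f u (rcons t v) * (path (adjacent ed g) u (rcons t v))%:R).
have F0 k t f g : 0 <= @F k t f g.
  by rewrite mulr_ge0// mulr_ge0// chain_ge0.
(* Markov's inequality: on a bad sample, one of the nonnegative terms is at least 1. *)
apply: (@le_trans _ _ (EX w (fun f => EX (bern p) (fun g =>
    \sum_(k < #|V|) \sum_(t : k.-tuple V | uniq (u :: rcons t v)) F k t f g)))).
  apply: le_EX => // f; apply: le_EX; first exact: bern_ge0.
  move=> g; case: (boolP (Bad f g)) => [/badP[t [ut pt Bt]]|_]; last first.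
    by rewrite sumr_ge0// => k _; rewrite sumr_ge0.
  have kV : (size t < #|V|)%N.
    have := max_card (mem (u :: rcons t v)).
    by rewrite (card_uniqP ut)/= size_rcons => /ltnW.
  rewrite (bigD1 (Ordinal kV))//= (bigD1 (in_tuple t))//= -addrA.
  apply: ler_wpDr; last by rewrite /F pt mulr1.
  rewrite addr_ge0//; first by rewrite sumr_ge0.
  by rewrite sumr_ge0// => k _; rewrite sumr_ge0.
apply: (@le_trans _ _ (\sum_(k < #|V|)
    \sum_(t : k.-tuple V | uniq (u :: rcons t v)) B * (p * kappa) ^+ k.+1)).
  under eq_EX do rewrite EX_sum.
  rewrite EX_sum; apply: ler_sum => k _.
  under eq_EX do rewrite EX_sum.
  rewrite EX_sum; apply: ler_sum => t ut.
  under eq_EX => f.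
    rewrite EXZ EXZ prob_path// size_rcons size_tuple; over.
  rewrite EXZ ler_wpM2l// exprMn mulrC.
  have -> : EX w (fun f => chain f u (rcons t v) * p ^+ k.+1) =
            p ^+ k.+1 * EX w (fun f => chain f u (rcons t v)).
    by rewrite -EXZ; apply: eq_EX => f; rewrite mulrC.
  rewrite mulrC ler_wpM2l ?exprn_ge0//.
  by apply: le_trans (EX_chain ut) _; rewrite size_rcons size_tuple.
have pk0 : 0 <= p * kappa by rewrite mulr_ge0.
(* With n the number of vertices, at most n^k choices of interior vertices meet (p kappa)^(k+1) <=
   (1/(2n))^(k+1); a factor 1/n and a geometric series remain. *)
apply: (@le_trans _ _ (\sum_(k < #|V|) B / #|V|%:R * 2^-1 ^+ k.+1)).
  apply: ler_sum => k _; rewrite sumr_const -[leLHS]mulr_natr -!mulrA ler_wpM2l//.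
  apply: (@le_trans _ _ ((p * kappa) ^+ k.+1 * (#|V| ^ k)%:R)).
    by rewrite ler_wpM2l ?exprn_ge0// ler_nat -card_tuple max_card.
  rewrite ler_pdivlMl ?ltr0n// mulrCA -natrM -expnS natrX -exprMn.
  by rewrite mulrC lerXn2r// ?nnegrE ?mulr_ge0.
rewrite -mulr_sumr ler_piMr ?divr_ge0//.
have -> (m : nat) : \sum_(k < m) 2^-1 ^+ k.+1 = 1 - 2^-1 ^+ m :> R.
  elim: m => [|m IH]; first by rewrite big_ord0 subrr.
  by rewrite big_ord_recr/= IH exprS; lra.
by rewrite gerBl exprn_ge0.
Qed.

End FirstMoment.

(** * Grids of cells *)

Section Grid.
Variables (R : realFieldType) (d M : nat).
Definition grid := {ffun 'I_d -> 'I_M}.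

(** The absolute difference: one of the truncated subtractions vanishes. *)
Definition gap (s t : nat) : nat := ((s - t) + (t - s))%N.

(** The term [t = s] gives 1, and the geometric series on either side at most 1 each. *)
Lemma sum_half_gap (s : nat) : \sum_(t < M) 2^-1 ^+ gap t s <= 3 :> R.
Proof.
have below m : (m <= s)%N -> \sum_(t < m) 2^-1 ^+ gap t s <= 2^-1 ^+ (s - m) :> R.
  elim: m => [|m IH] ms; first by rewrite big_ord0 exprn_ge0.
  rewrite big_ord_recr/= (le_trans (lerD (IH (ltnW ms)) (lexx _)))//.
  have -> : gap m s = (s - m)%N by rewrite /gap; lia.
  by have -> : (s - m = (s - m.+1).+1)%N by [lia|]; rewrite exprS; lra.
have [Ms|sM] := leqP M s.
  by rewrite (le_trans (below _ Ms))// (le_trans (exprn_ile1 _ _ _))//; lra.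
have above m : \sum_(t < s.+1 + m) 2^-1 ^+ gap t s <= 3 - 2^-1 ^+ m :> R.
  elim: m => [|m IH].
    rewrite addn0 big_ord_recr/= /gap subnn expr0.
    by have := below _ (leqnn s); rewrite subnn expr0; lra.
  rewrite addnS big_ord_recr/= (le_trans (lerD IH (lexx _)))//.
  by have -> : gap (s.+1 + m) s = m.+1 by [rewrite /gap; lia|]; rewrite exprS; lra.
have := above (M - s.+1)%N; rewrite subnKC// => /le_trans; apply.
by rewrite gerBl exprn_ge0.
Qed.

Definition unif (c : grid) : R := (M%:R ^+ d)^-1.

Lemma unif_ge0 c : 0 <= unif c.
Proof. by rewrite invr_ge0 exprn_ge0. Qed.

Lemma unif_sum1 : (0 < M)%N -> \sum_c unif c = 1.
Proof.
move=> M0; rewrite sumr_const card_ffun !card_ord -[LHS]mulr_natr natrX mulVf//.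
by rewrite expf_neq0// pnatr_eq0 -lt0n.
Qed.

(** A product over coordinates that dominates e^(-mu distance) for mu = d M, so that its mean
    factors. *)
Definition grid_kernel (c c' : grid) : R := \prod_k (4 * 2^-1 ^+ gap (c k) (c' k)).

Lemma grid_kernel_ge0 c c' : 0 <= grid_kernel c c'.
Proof. by apply: prodr_ge0 => k _; rewrite mulr_ge0// exprn_ge0. Qed.

Lemma grid_kernel_mean c' :
  \sum_c unif c * grid_kernel c c' <= (12 / M%:R) ^+ d.
Proof.
rewrite -mulr_sumr /unif /grid_kernel.
rewrite -(bigA_distr_bigA (fun (k : 'I_d) (t : 'I_M) => 4 * 2^-1 ^+ gap t (c' k)))/=.
rewrite exprMn exprVn mulrC ler_wpM2r ?invr_ge0 ?exprn_ge0//.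
rewrite -[X in 12 ^+ X](card_ord d) -prodr_const; apply: ler_prod => k _.
rewrite sumr_ge0 => [|t _]; last by rewrite mulr_ge0// exprn_ge0.
by rewrite -mulr_sumr; have := sum_half_gap (c' k); lra.
Qed.

(** Chernoff's bound: the indicator is at most 2^(m - occupancy), and 2^(-occupancy) is a product
    over the vertices. *)
Lemma occupancy (V : finType) (m : nat) (c : grid) : (0 < M)%N ->
  EX unif (fun f : {ffun V -> grid} => (#|[set i | f i == c]| < m)%N%:R) <=
  2 ^+ m * (1 - (2 * M%:R ^+ d)^-1) ^+ #|V|.
Proof.
move=> M0.
have -> : 1 - (2 * M%:R ^+ d)^-1 =
    \sum_c' unif c' * (if c' == c then 2^-1 else 1) :> R.
  rewrite -[X in X - _](unif_sum1 M0) (bigD1 c)//= [RHS](bigD1 c)//= eqxx.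
  under [in RHS]eq_bigr => i /negPf ic do rewrite ic mulr1.
  by have -> : (2 * M%:R ^+ d)^-1 = 2^-1 * unif c by [exact: invfM|]; lra.
rewrite -(EX_prod V) -EXZ; apply: le_EX; first exact: unif_ge0.
move=> f.
have -> : \prod_i (if f i == c then 2^-1 else 1) =
    2^-1 ^+ #|[set i | f i == c]| :> R.
  rewrite -prodr_const [RHS]big_mkcond/=.
  by apply: eq_bigr => i _; rewrite inE.
case: ltnP => cm; last by rewrite mulr_ge0// exprn_ge0.
by rewrite exprVn ler_pdivlMr ?exprn_gt0// mul1r ler_eXn2l ?ltr1n// ltnW.
Qed.

End Grid.

Section Coarse.
Variables (d K L : nat).
Hypothesis L_gt0 : (0 < L)%N.

Lemma coarse_subproof (t : 'I_(K * L)) : (t %/ L < K)%N.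
Proof. by rewrite ltn_divLR. Qed.

Definition coarse (c : grid d (K * L)) : grid d K :=
  [ffun k => Ordinal (coarse_subproof (c k))].

Lemma refine_subproof (s : 'I_K) (t : 'I_L) : (s * L + t < K * L)%N.
Proof.
by rewrite (@leq_trans (s.+1 * L))// ?leq_mul2r ?ltn_ord ?orbT// mulSn addnC ltn_add2r.
Qed.

Definition refine (b : grid d K) (r : grid d L) : grid d (K * L) :=
  [ffun k => Ordinal (refine_subproof (b k) (r k))].

Lemma refineK b r : coarse (refine b r) = b.
Proof.
by apply/ffunP => k; apply: val_inj; rewrite !ffunE/= divnMDl// divn_small ?addn0.
Qed.

Lemma refine_inj b : injective (refine b).
Proof.
move=> r r' /ffunP rr'; apply/ffunP => k; have := rr' k.
by rewrite !ffunE => -[/addnI /val_inj].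
Qed.

(** A coarse cell is the disjoint union of the [L ^ d] small cells [refine b r]. *)
Lemma coarse_occupancy (V : finType) (f : V -> grid d (K * L)) (m : nat) :
  (forall c, (m <= #|[set i | f i == c]|)%N) ->
  forall b, (L ^ d * m <= #|[set i | coarse (f i) == b]|)%N.
Proof.
move=> fm b.
have -> : (L ^ d * m = \sum_(r : grid d L) m)%N.
  by rewrite sum_nat_const card_ffun !card_ord.
apply: (@leq_trans (\sum_(r : grid d L) #|[set i | f i == refine b r]|)).
  by apply: leq_sum.
have -> : (\sum_(r : grid d L) #|[set i | f i == refine b r]| =
    \sum_(r : grid d L) \sum_i (f i == refine b r))%N.
  apply: eq_bigr => r _; rewrite -sum1_card big_mkcond/=.
  by apply: eq_bigr => i _; rewrite inE.
rewrite exchange_big/= -sum1_card [leqRHS]big_mkcond/=.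
apply: leq_sum => i _; rewrite inE.
case: (pickP (fun r => f i == refine b r)) => [r /eqP fr|no].
  rewrite (bigD1 r)//= fr eqxx refineK eqxx big1 => [|r' rr'].
    by rewrite addn0.
  by case: eqP => // /refine_inj e; rewrite e eqxx in rr'.
by rewrite big1 => [|r _]; rewrite ?no.
Qed.

End Coarse.

Local Open Scope classical_set_scope.

(** * From the probability space to the finite model *)

Lemma uniform_prob_subitv (R : realType) (a b : R) : 0 <= a -> a <= b -> b <= 1 ->
  uniform_prob (@ltr01 R) `[a, b[ = (b - a)%:E.
Proof.
move=> a0 ab b1; rewrite /uniform_prob integral_uniform_pdf setIidl; last first.
  move=> x /=; rewrite !in_itv/= => /andP[ax xb].
  by rewrite (le_trans a0 ax) (le_trans (ltW xb) b1).
transitivity (\int[lebesgue_measure]_(x in `[a, b[) (cst 1%E) x)%E.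
  apply: eq_integral => x; rewrite inE/= in_itv/= => /andP[ax xb].
  rewrite /uniform_pdf (le_trans a0 ax) (le_trans (ltW xb) b1)/=.
  by rewrite subr0 invr1.
rewrite integral_cst//= mul1e lebesgue_measure_itv/= lte_fin.
by move: ab; rewrite le_eqVlt => /orP[/eqP ->|->]; rewrite ?ltxx ?subrr// EFinB.
Qed.

Section Cells.
Variables (R : realType) (d M : nat).

(** Half-open, so that cells are disjoint. Points with a coordinate 1 lie in no cell; they form a
    null set, as the cells already have total mass 1. *)
Definition slot (t : 'I_M) : set R := `[t%:R / M%:R, t.+1%:R / M%:R[.

Definition cell (c : grid d M) : set (d.-tuple R) :=
  [set x | forall k, slot (c k) (tnth x k)].

Lemma uniform_prob_slot (t : 'I_M) :
  uniform_prob (@ltr01 R) (slot t) = M%:R^-1%:E.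
Proof.
have M0 : 0 < M%:R :> R by rewrite ltr0n (leq_ltn_trans _ (ltn_ord t)).
rewrite uniform_prob_subitv.
- by rewrite -mulrBl -natrB// subSnn mul1r.
- by rewrite divr_ge0.
- by rewrite ler_pM2r ?invr_gt0// ler_nat.
- by rewrite ler_pdivrMr// mul1r ler_nat.
Qed.

Lemma measurable_cell (c : grid d M) : measurable (cell c).
Proof.
rewrite (_ : cell c = \bigcap_(k in [set: 'I_d])
    ((fun x : d.-tuple R => tnth x k) @^-1` slot (c k))); last first.
  by apply/seteqP; split=> [x xc k _|x xc k]; [exact: xc|exact: xc].
apply: fin_bigcap_measurable => // k _.
rewrite -[X in measurable X]setTI.
by apply: (measurable_tnth k) => //; exact: measurable_itv.
Qed.

Lemma slot_inj (t t' : 'I_M) x : slot t x -> slot t' x -> t = t'.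
Proof.
have M0 : 0 < M%:R :> R by rewrite ltr0n (leq_ltn_trans _ (ltn_ord t)).
rewrite /slot /= !in_itv/= !ler_pdivrMr// !ltr_pdivlMr// => /andP[a b] /andP[a' b'].
apply: val_inj; apply/eqP; rewrite eqn_leq -!(@ltnS (nat_of_ord _)).
by rewrite -!(ltr_nat R) (le_lt_trans a b') (le_lt_trans a' b).
Qed.

Lemma cell_inj (c c' : grid d M) x : cell c x -> cell c' x -> c = c'.
Proof.
by move=> xc xc'; apply/ffunP => k; exact: slot_inj (xc k) (xc' k).
Qed.

Lemma slot_dist_le (t : 'I_M) (x y : R) : slot t x -> slot t y ->
  `|x - y| <= M%:R^-1.
Proof.
rewrite /slot /= !in_itv/= -[t.+1]addn1 natrD mulrDl mul1r => /andP[a b] /andP[a' b'].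
by rewrite ler_distl; apply/andP; split; lra.
Qed.

Lemma slot_dist_ge (t t' : 'I_M) (x y : R) : slot t x -> slot t' y ->
  (gap t t')%:R <= M%:R * `|x - y| + 1.
Proof.
have M0 : 0 < M%:R :> R by rewrite ltr0n (leq_ltn_trans _ (ltn_ord t)).
rewrite /slot /= !in_itv/= !ler_pdivrMr// !ltr_pdivlMr// => /andP[a b] /andP[a' b'].
rewrite -[X in X * `|_|](ger0_norm (ltW M0)) -normrM mulrBr.
rewrite -addn1 natrD in b; rewrite -addn1 natrD in b'.
have [tt'|t't] := leqP t t'.
  have -> : gap t t' = (t' - t)%N by rewrite /gap; lia.
  by rewrite natrB// distrC; have := ler_norm (M%:R * y - M%:R * x); lra.
have -> : gap t t' = (t - t')%N by rewrite /gap; lia.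
by rewrite natrB ?(ltnW t't)//; have := ler_norm (M%:R * x - M%:R * y); lra.
Qed.

End Cells.

Section Sampling.
Variables (dT : measure_display) (T : measurableType dT) (R : realType).
Variables (P : probability T R) (d n : nat) (p : R).
Variables (X : 'I_n -> {RV P >-> d.-tuple R}) (G : 'I_n -> 'I_n -> {RV P >-> bool}).
Hypothesis XG : random_embedded_graph p X G.

Lemma prob_cell (M : nat) (i : 'I_n) (c : grid d M) :
  P (X i @^-1` cell c) = (unif R c)%:E.
Proof.
have := @reg_position _ _ _ _ _ _ _ _ _ XG i (fun k => @slot R M (c k))
  (fun k => measurable_itv _).
rewrite /distribution /pushforward => ->.
under eq_bigr do rewrite uniform_prob_slot.
by rewrite prodEFin prodr_const card_ord exprVn.
Qed.

Lemma prob_edge (p01 : 0 <= p <= 1) (e : vertex_pair n) (b : bool) :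
  P (G (val e).1 (val e).2 @^-1` [set b]) = (bern p b)%:E.
Proof.
have mG : measurable [set w | G (val e).1 (val e).2 w].
  by rewrite -[X in measurable X]setTI; apply: (measurable_funPT (G _ _)).
have eT : G (val e).1 (val e).2 @^-1` [set true] = [set w | G (val e).1 (val e).2 w].
  by apply/seteqP; split=> w /=; [move=> ->|].
have PT := reg_edge XG (valP e).
case: b; first by rewrite eT PT.
have -> : G (val e).1 (val e).2 @^-1` [set false] = ~` [set w | G (val e).1 (val e).2 w].
  by apply/seteqP; split=> w /=; case: (G _ _ w).
by rewrite probability_setC// PT.
Qed.

Definition sample (M : nat) (f : {ffun 'I_n -> grid d M})
    (g : {ffun vertex_pair n -> bool}) : set T :=
  [set w | (forall i, cell (f i) (X i w)) /\
           (forall e, G (val e).1 (val e).2 w = g e)].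

(** The conditions of [sample] indexed as in [embedded_graph_sigma], so that independence applies to
    the full index set. *)
Definition sample_factor (M : nat) (f : {ffun 'I_n -> grid d M})
    (g : {ffun vertex_pair n -> bool}) (k : 'I_n + vertex_pair n) : set T :=
  match k with
  | inl i => X i @^-1` cell (f i)
  | inr e => G (val e).1 (val e).2 @^-1` [set g e]
  end.

Lemma sampleE M (f : {ffun 'I_n -> grid d M}) g :
  sample f g = \bigcap_(k in [set` [set: 'I_n + vertex_pair n]%SET]) sample_factor f g k.
Proof.
apply/seteqP; split=> [w [wf wg] [i|e] _|w H].
- exact: wf.
- exact: wg.
- by split=> [i|e]; [apply: (H (inl i))|apply: (H (inr e))]; rewrite /= inE.
Qed.

Lemma measurable_sample M (f : {ffun 'I_n -> grid d M}) g : measurable (sample f g).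
Proof.
rewrite sampleE; apply: fin_bigcap_measurable => // -[i|e] _ /=.
  by rewrite -[X in measurable X]setTI; apply: (measurable_funPT (X i)) => //;
    exact: measurable_cell.
by rewrite -[X in measurable X]setTI; apply: (measurable_funPT (G _ _)).
Qed.

Lemma prob_sample (p01 : 0 <= p <= 1) M (f : {ffun 'I_n -> grid d M}) g :
  P (sample f g) = ((\prod_i unif R (f i)) * \prod_e bern p (g e))%:E.
Proof.
rewrite sampleE (reg_indep XG); last first.
  move=> [i|e] _ /=.
    by exists (cell (f i)); [exact: measurable_cell|rewrite setTI].
  by exists [set g e]; [|rewrite setTI].
rewrite big_mkcond/= (eq_bigr (fun k => P (sample_factor f g k))) => [|k _]; last first.
  by rewrite inE.
rewrite big_sumType/= EFinM -!prodEFin; congr (_ * _)%E.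
- by apply: eq_bigr => i _; rewrite prob_cell.
- by apply: eq_bigr => e _; rewrite prob_edge.
Qed.

Lemma sample_inj M (f f' : {ffun 'I_n -> grid d M}) g g' w :
  sample f g w -> sample f' g' w -> (f, g) = (f', g').
Proof.
move=> [wf wg] [wf' wg']; congr pair; apply/ffunP.
- by move=> i; exact: cell_inj (wf i) (wf' i).
- by move=> e; rewrite -wg -wg'.
Qed.

(** The good samples are disjoint events inside [A], of total mass 1 minus the right-hand side. Bad
    samples may still meet [A]. *)
Lemma prob_le_EX (p01 : 0 <= p <= 1) (M : nat) (A : set T)
    (Bad : {ffun 'I_n -> grid d M} -> {ffun vertex_pair n -> bool} -> bool) :
  (0 < M)%N -> measurable A ->
  (forall f g, ~~ Bad f g -> sample f g `<=` A) ->
  (P (~` A) <= (EX (@unif R d M) (fun f => EX (bern p) (fun g => (Bad f g)%:R)))%:E)%E.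
Proof.
move=> M0 mA BadA.
pose F (fg : {ffun 'I_n -> grid d M} * {ffun vertex_pair n -> bool}) : set T :=
  if Bad fg.1 fg.2 then set0 else sample fg.1 fg.2.
have mF fg : measurable (F fg).
  by rewrite /F; case: ifP => // _; exact: measurable_sample.
have tF : trivIset setT F.
  apply/trivIsetP => -[f g] [f' g'] _ _ ne; rewrite /F/=.
  case: ifP => _; first by rewrite set0I.
  case: ifP => _; first by rewrite setI0.
  by rewrite -subset0 => w [/sample_inj h /h e]; rewrite e eqxx in ne.
have FA : \bigcup_fg F fg `<=` A.
  move=> w [[f g] _]; rewrite /F/=; case: (boolP (Bad f g)) => // /BadA; exact.
have PF : P (\bigcup_fg F fg) =
    (1 - EX (@unif R d M) (fun f => EX (bern p) (fun g => (Bad f g)%:R)))%:E.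
  rewrite measure_fin_bigcup//; last exact: finite_finset.
  rewrite (_ : setT = [set` index_enum _]); last first.
    by apply/seteqP; split=> fg //= _; rewrite mem_index_enum.
  rewrite -fsbig_seq ?index_enum_uniq//.
  rewrite -[X in (X - _)%:E](EX_cst 'I_n (unif_sum1 R d M0) 1) /EX -sumrB.
  transitivity (\sum_f \sum_g P (F (f, g)))%E.
    by rewrite pair_big; apply: eq_bigr => -[].
  rewrite -sumEFin; apply: eq_bigr => f _.
  rewrite -mulrBr -[X in _ * (X - _)](EX_cst (vertex_pair n) (bern_sum1 p) 1) /EX.
  rewrite -sumrB mulr_sumr -sumEFin; apply: eq_bigr => g _.
  rewrite -mulrBr mulrA /F/=; case: (Bad f g).
    by rewrite measure0 /= subrr mulr0.
  by rewrite subr0 mulr1 prob_sample.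
rewrite probability_setC//.
have : (P (\bigcup_fg F fg) <= P A)%E.
  apply: le_measure; rewrite ?inE//; apply: fin_bigcup_measurable => //.
  exact: finite_finset.
rewrite PF -(fineK (fin_num_measure P A mA)) -EFinB !lee_fin; lra.
Qed.

End Sampling.

(** * Graph distance and its measurability *)

Section Euclid.
Variables (R : realType) (d : nat).
Implicit Types x y z : d.-tuple R.

(** For B nonzero, expand the sum of the squares (B a_i - C b_i)^2, which equals B (A B - C^2). *)
Lemma cauchy_schwarz (I : finType) (a b : I -> R) :
  (\sum_i a i * b i) ^+ 2 <= (\sum_i a i ^+ 2) * (\sum_i b i ^+ 2).
Proof.
set A := \sum_i a i ^+ 2; set B := \sum_i b i ^+ 2; set C := \sum_i a i * b i.
have B0 : 0 <= B by apply: sumr_ge0 => i _; exact: sqr_ge0.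
have [B_eq0|B_neq0] := eqVneq B 0.
  have b0 i : b i = 0.
    apply/eqP; rewrite -sqrf_eq0; apply/eqP.
    by apply: (psumr_eq0P (F := fun i => b i ^+ 2) _ B_eq0) => // j _; exact: sqr_ge0.
  by rewrite /C big1 ?B_eq0 ?mulr0 ?expr0n// => i _; rewrite b0 mulr0.
have : 0 <= \sum_i (B * a i - C * b i) ^+ 2 by apply: sumr_ge0 => i _; exact: sqr_ge0.
have -> : \sum_i (B * a i - C * b i) ^+ 2 = B ^+ 2 * A - 2 * B * C * C + C ^+ 2 * B.
  have expand (x y : R) : \sum_i (x * a i - y * b i) ^+ 2 =
      x ^+ 2 * A - 2 * x * y * C + y ^+ 2 * B.
    rewrite /A /B /C !mulr_sumr -sumrB -big_split/=.
    by apply: eq_bigr => i _; ring.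
  exact: expand.
have -> : B ^+ 2 * A - 2 * B * C * C + C ^+ 2 * B = B * (A * B - C ^+ 2) by ring.
by rewrite pmulr_rge0 ?subr_ge0// lt_def B_neq0.
Qed.

Lemma eucl_dist_ge0 x y : 0 <= eucl_dist x y.
Proof. exact: sqrtr_ge0. Qed.

Lemma eucl_distC x y : eucl_dist x y = eucl_dist y x.
Proof. by congr Num.sqrt; apply: eq_bigr => k _; rewrite -sqrrN opprB. Qed.

Lemma eucl_dist_triangle y x z : eucl_dist x z <= eucl_dist x y + eucl_dist y z.
Proof.
rewrite /eucl_dist.
set a := fun k => tnth x k - tnth y k; set b := fun k => tnth y k - tnth z k.
set A := \sum_k a k ^+ 2; set B := \sum_k b k ^+ 2.
have A0 : 0 <= A by apply: sumr_ge0 => i _; exact: sqr_ge0.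
have B0 : 0 <= B by apply: sumr_ge0 => i _; exact: sqr_ge0.
have -> : \sum_(k < d) (tnth x k - tnth z k) ^+ 2 = A + B + 2 * \sum_k a k * b k.
  rewrite mulr_sumr -!big_split/=; apply: eq_bigr => k _.
  by rewrite /a /b; ring.
rewrite -[leRHS]ger0_norm ?addr_ge0 ?sqrtr_ge0// -sqrtr_sqr ler_sqrt; last first.
  exact: sqr_ge0.
rewrite sqrrD !sqr_sqrtr//.
have : \sum_k a k * b k <= Num.sqrt A * Num.sqrt B.
  rewrite (le_trans (ler_norm _))// -sqrtr_sqr -sqrtrM// ler_wsqrtr//.
  exact: cauchy_schwarz.
set C := \sum_k _; set D := _ * _; lra.
Qed.

Lemma coord_le_eucl_dist x y k : `|tnth x k - tnth y k| <= eucl_dist x y.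
Proof.
rewrite -sqrtr_sqr; apply: ler_wsqrtr.
by rewrite (bigD1 k)//= lerDl sumr_ge0// => i _; exact: sqr_ge0.
Qed.

Lemma eucl_dist_le (r : R) x y : 0 <= r ->
  (forall k, `|tnth x k - tnth y k| <= r) -> eucl_dist x y <= d%:R * r.
Proof.
move=> r0 xyr; rewrite -[leRHS]ger0_norm ?mulr_ge0// -sqrtr_sqr.
apply: ler_wsqrtr; apply: (@le_trans _ _ (\sum_(k < d) r ^+ 2)).
  apply: ler_sum => k _; rewrite -(real_normK (num_real (_ - _))).
  by rewrite lerXn2r// ?nnegrE ?normr_ge0.
rewrite sumr_const card_ord -[leLHS]mulr_natl exprMn ler_wpM2r ?sqr_ge0//.
by rewrite -natrX ler_nat -mulnn; case: (d) => // m; rewrite leq_pmulr.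
Qed.

Variable n : nat.
Implicit Types (X : 'I_n -> d.-tuple R) (G : rel 'I_n) (s : seq 'I_n).

Lemma path_length_nil X u : path_length X u [::] = 0.
Proof. by rewrite /path_length big_nil. Qed.

Lemma path_length_cons X u a s :
  path_length X u (a :: s) = eucl_dist (X u) (X a) + path_length X a s.
Proof. by rewrite /path_length /= big_cons. Qed.

Lemma path_length_ge0 X u s : 0 <= path_length X u s.
Proof.
elim: s u => [|a s IH] u; first by rewrite path_length_nil.
by rewrite path_length_cons addr_ge0// eucl_dist_ge0.
Qed.

Lemma path_length_cat X u s t :
  path_length X u (s ++ t) = path_length X u s + path_length X (last u s) t.
Proof.
elim: s u => [|a s IH] u /=; first by rewrite path_length_nil add0r.
by rewrite !path_length_cons IH addrA.
Qed.

Lemma path_length_rcons X u s a : path_length X u (rcons s a) =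
  path_length X u s + eucl_dist (X (last u s)) (X a).
Proof.
by rewrite -cats1 path_length_cat path_length_cons path_length_nil addr0.
Qed.

Lemma eucl_dist_le_path_length X u s :
  eucl_dist (X u) (X (last u s)) <= path_length X u s.
Proof.
elim: s u => [|a s IH] u /=.
  by rewrite path_length_nil /eucl_dist big1 ?sqrtr0// => k _; rewrite subrr expr0n.
rewrite path_length_cons (le_trans (eucl_dist_triangle (X a) _ _))//.
by rewrite lerD2l.
Qed.

(** Loop erasure, vertex by vertex: if the new end already occurs, cut back to it, which does not
    increase the length. *)
Lemma shorten_walk X G u s : path G u s -> exists s',
  [/\ path G u s', last u s' = last u s, uniq (u :: s') &
      path_length X u s' <= path_length X u s].
Proof.
elim/last_ind: s => [|s b IH]; first by exists [::].
rewrite rcons_path last_rcons path_length_rcons => /andP[/IH[s' [ps' ls' us' len]] eb].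
have [bs'|bs'] := boolP (b \in u :: s'); last first.
  exists (rcons s' b); rewrite rcons_path last_rcons path_length_rcons ps' ls' eb.
  by rewrite -rcons_cons rcons_uniq bs' us' lerD2r.
case/splitPl: bs' ps' us' len {ls'} => s1 s2 ls1.
rewrite cat_path -cat_cons cat_uniq path_length_cat => /andP[ps1 _] /andP[us1 _] len.
exists s1; split=> //.
have := path_length_ge0 X (last u s1) s2.
have := eucl_dist_ge0 (X (last u s)) (X b).
lra.
Qed.

Lemma graph_dist_le_walk X G u s : path G u s ->
  (graph_dist X G u (last u s) <= (path_length X u s)%:E)%E.
Proof.
move=> /(shorten_walk X)[s' [ps' ls' us' len]].
rewrite (le_trans (ereal_inf_lbound _) (_ : (path_length X u s')%:E <= _)%E)//.
by exists s'.
Qed.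

Lemma le_graph_dist X G u v (c : \bar R) :
  (c <= graph_dist X G u v)%E <-> (forall s, path G u s -> last u s = v ->
    uniq (u :: s) -> (c <= (path_length X u s)%:E)%E).
Proof.
split=> [cD s ps ls us|H].
  by rewrite (le_trans cD)//; apply: ereal_inf_lbound; exists s.
by apply: le_ereal_inf_tmp => _ [s [ps ls us] <-]; exact: H.
Qed.

Lemma eucl_dist_le_graph_dist X G u v :
  ((eucl_dist (X u) (X v))%:E <= graph_dist X G u v)%E.
Proof.
apply/le_graph_dist => s _ <- _; rewrite lee_fin.
exact: eucl_dist_le_path_length.
Qed.

End Euclid.

Section Measurability.
Variables (dT : measure_display) (T : measurableType dT) (R : realType).
Variables (P : probability T R) (d n : nat).
Variables (X : 'I_n -> {RV P >-> d.-tuple R}) (G : 'I_n -> 'I_n -> {RV P >-> bool}).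

Lemma measurable_eucl_dist i j :
  measurable_fun [set: T] (fun w => eucl_dist (X i w) (X j w)).
Proof.
apply: (measurableT_comp (f := @Num.sqrt R)).
  exact: continuous_measurable_fun (@sqrt_continuous R).
apply: measurable_sum => k; apply: measurable_funX; apply: measurable_funB.
- by apply: (measurableT_comp (measurable_tnth k)).
- by apply: (measurableT_comp (measurable_tnth k)).
Qed.

Lemma measurable_path_length u s :
  measurable_fun [set: T] (fun w => path_length (fun i => X i w) u s).
Proof.
elim: s u => [|a s IH] u.
  by under eq_fun do rewrite path_length_nil; exact: measurable_cst.
under eq_fun do rewrite path_length_cons.
by apply: measurable_funD; [exact: measurable_eucl_dist|exact: IH].
Qed.

Lemma measurable_path u s :
  measurable [set w | path (fun i j => G i j w) u s].
Proof.
elim: s u => [|a s IH] u /=; first by rewrite (_ : mkset _ = setT)//; apply/seteqP.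
rewrite (_ : mkset _ = [set w | G u a w] `&` [set w | path (fun i j => G i j w) a s]).
  apply: measurableI => //.
  by rewrite -[X in measurable X]setTI; apply: (measurable_funPT (G _ _)).
by apply/seteqP; split=> w /= /andP.
Qed.

(** In the complement some path is shorter than [c]: a countable union over vertex sequences. *)
Lemma measurable_le_random_dist (c : T -> R) i j : measurable_fun [set: T] c ->
  measurable [set w | ((c w)%:E <= random_dist X G w i j)%E].
Proof.
move=> mc.
pose F (s : seq 'I_n) : set T := if (last i s == j) && uniq (i :: s) then
  [set w | path (fun i j => G i j w) i s] `&`
  [set w | path_length (fun i => X i w) i s < c w] else set0.
have -> : [set w | ((c w)%:E <= random_dist X G w i j)%E] = ~` \bigcup_s F s.
  apply/seteqP; split=> w /=.
    move=> /le_graph_dist H [s _]; rewrite /F; case: ifP => // /andP[/eqP ls us] [ps].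
    by rewrite /= ltNge -lee_fin H.
  move=> H; apply/le_graph_dist => s ps ls us; rewrite lee_fin leNgt; apply/negP => sc.
  by apply: H; exists s => //; rewrite /F ls eqxx us.
apply: measurableC; apply: countable_bigcupT_measurable; first exact: countableP.
move=> s; rewrite /F; case: ifP => // _; apply: measurableI.
  exact: measurable_path.
rewrite -[X in measurable X]setTI.
have mlt := measurable_fun_ltr (measurable_path_length i s) mc.
exact: (mlt measurableT [set true]).
Qed.

(** Reduces to the reverse inequality by approaching [c] from above along [c + 1 / (m + 1)]. *)
Lemma measurable_random_dist_le (c : T -> R) i j : measurable_fun [set: T] c ->
  measurable [set w | (random_dist X G w i j <= (c w)%:E)%E].
Proof.
move=> mc.
have -> : [set w | (random_dist X G w i j <= (c w)%:E)%E] =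
    \bigcap_m ~` [set w | ((c w + m.+1%:R^-1)%:E <= random_dist X G w i j)%E].
  apply/seteqP; split=> w /=.
    move=> H m _ /= H'; have := le_trans H' H.
    by rewrite lee_fin gerDl leNgt invr_gt0 ltr0n.
  move=> H; apply/lee_addgt0Pr => e e0; rewrite -EFinD.
  pose m := Num.truncn e^-1.
  have /negP := H m I; rewrite -ltNge => /ltW/le_trans; apply.
  rewrite lee_fin lerD2l invf_ple ?posrE ?ltr0n//.
  by rewrite ltW// truncnS_gt.
apply: bigcapT_measurable => m; apply: measurableC.
apply: measurable_le_random_dist; apply: measurable_funD => //.
Qed.

End Measurability.

(** * Failure probabilities at a fixed number of vertices *)

Section Edges.
Variables (n : nat) (e0 : vertex_pair n).

(** The default [e0] is returned only on the diagonal, where [adjacent] is false anyway. *)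
Definition edge_of (a b : 'I_n) : vertex_pair n :=
  insubd e0 (if (a < b)%N then (a, b) else (b, a)).

Lemma val_edge_of (a b : 'I_n) : a != b ->
  val (edge_of a b) = if (a < b)%N then (a, b) else (b, a).
Proof.
move=> ab; rewrite val_insubd; case: (ltnP a b) => [/= ->//|ba /=].
by rewrite ltn_neqAle ba eq_sym val_eqE ab.
Qed.

Lemma edge_of_inj (a b c d : 'I_n) : a != b -> c != d -> edge_of a b = edge_of c d ->
  (a == c) && (b == d) || (a == d) && (b == c).
Proof.
move=> ab cd /(congr1 val); rewrite !val_edge_of//.
by case: ifP => _; case: ifP => _ [-> ->]; rewrite !eqxx ?orbT.
Qed.

Lemma vertex_pair_of (u v : 'I_n) : u != v -> exists e : vertex_pair n, True.
Proof.
rewrite -val_eqE neq_ltn => /orP[uv|vu].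
- by exists (exist (fun e : 'I_n * 'I_n => (e.1 < e.2)%N) (u, v) uv).
- by exists (exist (fun e : 'I_n * 'I_n => (e.1 < e.2)%N) (v, u) vu).
Qed.

End Edges.

Section FixedSize.
Variables (dT : measure_display) (T : measurableType dT) (R : realType).
Variables (P : probability T R) (d n : nat) (p : R).
Variables (X : 'I_n -> {RV P >-> d.-tuple R}) (G : 'I_n -> 'I_n -> {RV P >-> bool}).
Hypothesis XG : random_embedded_graph p X G.
Hypothesis p01 : 0 <= p <= 1.

Lemma sample_adjacent (M : nat) (f : {ffun 'I_n -> grid d M}) g e0 w :
  sample X G f g w -> adjacent (edge_of e0) g =2 (fun a b => G a b w).
Proof.
move=> [_ wg] a b; rewrite /adjacent; have [->|ab] /= := eqVneq a b.
  by rewrite (reg_irrefl XG).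
rewrite -wg val_edge_of//; case: ifP => //= _.
exact: (reg_sym XG).
Qed.

Lemma expR_path_length_le_chain (M : nat) (h : grid d M -> grid d M -> R) (mu : R)
    (f : {ffun 'I_n -> grid d M}) w u s :
  (forall c c' x y, cell c x -> cell c' y -> expR (- (mu * eucl_dist x y)) <= h c c') ->
  (forall i, cell (f i) (X i w)) ->
  expR (- (mu * path_length (fun i => X i w) u s)) <= chain h f u s.
Proof.
move=> hP wf; elim: s u => [|a s IH] u /=.
  by rewrite path_length_nil mulr0 oppr0 expR0.
rewrite path_length_cons mulrDr opprD expRD.
by apply: ler_pM; rewrite ?expR_ge0//; exact: hP.
Qed.

(** A path shorter than [D] has e^(mu (D - length)) >= 1. Since [chain] dominates e^(-mu length)
    through the cells alone, this passes to the finite model, where [first_moment] applies. *)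
Lemma prob_short_dist (M : nat) (h : grid d M -> grid d M -> R) (kappa mu D : R)
    (u v : 'I_n) :
  (0 < M)%N -> u != v -> 0 <= mu ->
  (forall c c', 0 <= h c c') ->
  (forall c', \sum_c unif R c * h c c' <= kappa) ->
  (forall c c' x y, cell c x -> cell c' y -> expR (- (mu * eucl_dist x y)) <= h c c') ->
  n%:R * (p * kappa) <= 2^-1 ->
  (P (~` [set w | (D%:E <= random_dist X G w u v)%E]) <= (expR (mu * D) / n%:R)%:E)%E.
Proof.
move=> M0 uv mu0 h0 hk hP npk.
have [e0 _] := vertex_pair_of uv.
pose B := expR (mu * D).
pose Bad (f : {ffun 'I_n -> grid d M}) g := `[< exists t : seq 'I_n,
  [/\ uniq (u :: rcons t v), path (adjacent (edge_of e0) g) u (rcons t v) &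
      1 <= B * chain h f u (rcons t v)] >].
apply: (@le_trans _ _ (EX (@unif R d M) (fun f => EX (bern p) (fun g => (Bad f g)%:R)))%:E).
  apply: (prob_le_EX XG) => //.
    exact/measurable_le_random_dist/measurable_cst.
  move=> f g /asboolP nb w wfg; apply/le_graph_dist => s ps ls us.
  rewrite lee_fin leNgt; apply/negP => sD; apply: nb.
  case/lastP: s => [|t b] in ps ls us sD *; first by rewrite /= in ls; rewrite ls eqxx in uv.
  rewrite last_rcons in ls; subst b; exists t; split=> //.
    by rewrite (eq_path (sample_adjacent e0 wfg)).
  have := expR_path_length_le_chain u (rcons t v) hP wfg.1.
  move=> /(ler_wpM2l (expR_ge0 (mu * D))) h1; apply: le_trans h1.
  by rewrite -expRD -expR0 ler_expR -mulrBr mulr_ge0// subr_ge0 ltW.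
rewrite lee_fin -[X in _ / X%:R](card_ord n).
apply: (first_moment p01 (@edge_of_inj _ e0) (@unif_ge0 R d M) (unif_sum1 R d M0)
  h0 hk (expR_ge0 _)); rewrite ?card_ord// => f g /asboolP; exact.
Qed.

(** Both bounds come from 1 + x <= e^x, at x = 1 and at x = -1/2, the latter squared. *)
Lemma expR1_bounds : 2 <= (expR 1 : R) <= 4.
Proof.
have h : 2 <= expR 1 :> R by have := expR_ge1Dx (1 : R); lra.
rewrite h/=; have := expR_ge1Dx (- 2^-1 : R); have := expR_gt0 (- 2^-1 : R).
have : expR 1 * (expR (- 2^-1) * expR (- 2^-1)) = 1 :> R.
  by rewrite -!expRD -[RHS]expR0; congr expR; lra.
set x := expR (- _); set e := expR 1 => ex x0 x2.
have : e * (2^-1 * 2^-1) <= 1.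
  by rewrite -[leRHS]ex ler_wpM2l ?expR_ge0// ler_pM//; lra.
lra.
Qed.

(** Each of the [d] coordinates takes a share M of the exponent. There M times the distance is at
    least gap - 1, and e^(1 - gap) <= 4 / 2^gap because 2 <= e <= 4. *)
Lemma expR_eucl_dist_le_kernel (M : nat) (c c' : grid d M) (x y : d.-tuple R) :
  cell c x -> cell c' y ->
  expR (- ((d * M)%:R * eucl_dist x y)) <= grid_kernel R c c'.
Proof.
move=> cx cy; have /andP[e2 e4] := expR1_bounds.
have -> : expR (- ((d * M)%:R * eucl_dist x y)) =
    \prod_(k < d) expR (- (M%:R * eucl_dist x y)).
  by rewrite prodr_const card_ord -expRM_natl natrM mulrN mulrA.
apply: ler_prod => k _; rewrite expR_ge0/=.
apply: (@le_trans _ _ (expR (1 - (gap (c k) (c' k))%:R))).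
  rewrite ler_expR; have := slot_dist_ge (cx k) (cy k).
  have := ler_wpM2l (ler0n R M) (coord_le_eucl_dist x y k); lra.
rewrite expRD expRN; move: (gap _ _) => m.
have -> : expR m%:R = expR 1 ^+ m :> R by rewrite -expRM_natl mulr1.
rewrite exprVn; apply: ler_pM; rewrite ?invr_ge0 ?exprn_ge0 ?expR_ge0//.
by rewrite lef_pV2 ?posrE ?exprn_gt0 ?expR_gt0// lerXn2r// nnegrE ?expR_ge0.
Qed.

(** Both directions are built, since a connection leaves [u] along one such walk and arrives at [v]
    along another one reversed. *)
Lemma near_walk (Co Sm : eqType) (co : 'I_n -> Co) (sm : 'I_n -> Sm) (e : rel 'I_n)
    (x : 'I_n -> d.-tuple R) (r1 r0 : R) u k a :
  symmetric e ->
  (forall a b, co a = co b -> eucl_dist (x a) (x b) <= r1) ->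
  (forall a b, sm a = sm b -> eucl_dist (x a) (x b) <= r0) ->
  near co sm e u k a -> exists s t,
    [/\ path e u s, last u s = a, path e a t & last a t = u] /\
    path_length x u s <= r1 + k%:R * r0 /\ path_length x a t <= r1 + k%:R * r0.
Proof.
move=> e_sym cor smr; elim: k a => [|k IH] a /=.
  move=> /andP[/eqP ua eua]; exists [:: a], [:: u]; rewrite /= eua e_sym eua.
  by rewrite !path_length_cons !path_length_nil mul0r !addr0 !cor.
move=> /existsP[b /and3P[/IH[s [t [[ps ls pt lt] [lens lent]]]] /eqP ba eba]].
exists (rcons s a), (b :: t); rewrite rcons_path last_rcons path_length_rcons ps ls eba.
rewrite /= e_sym eba pt path_length_cons -addn1 natrD mulrDl mul1r addrA.
have ab := smr _ _ ba; have ba' := smr _ _ (esym ba).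
split; first by [].
by split; [exact: lerD|rewrite addrC lerD].
Qed.

(** With r = r1 + k r0, the two walks cost 2 r, and the joining edge is at most 2 r longer than the
    distance from [u] to [v]. *)
Lemma graph_dist_joined (Co Sm : eqType) (co : 'I_n -> Co) (sm : 'I_n -> Sm)
    (e : rel 'I_n) (x : 'I_n -> d.-tuple R) (r1 r0 : R) u v k a b :
  symmetric e ->
  (forall a b, co a = co b -> eucl_dist (x a) (x b) <= r1) ->
  (forall a b, sm a = sm b -> eucl_dist (x a) (x b) <= r0) ->
  near co sm e u k a -> near co sm e v k b -> e a b ->
  (graph_dist x e u v <= (eucl_dist (x u) (x v) + 4 * (r1 + k%:R * r0))%:E)%E.
Proof.
move=> e_sym cor smr.
move=> /(near_walk e_sym cor smr)[s [s' [[ps ls _ _] [lens _]]]].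
move=> /(near_walk e_sym cor smr)[t' [t [[_ _ pt lt] [_ lent]]]] eab.
have pst : path e u (s ++ b :: t) by rewrite cat_path ps ls/= eab pt.
have lst : last u (s ++ b :: t) = v by rewrite last_cat.
rewrite -[in leLHS]lst (le_trans (graph_dist_le_walk x pst))// lee_fin.
rewrite path_length_cat ls path_length_cons.
have ua := eucl_dist_le_path_length x u s; rewrite ls in ua.
have bv := eucl_dist_le_path_length x b t; rewrite lt in bv.
have := eucl_dist_triangle (x u) (x a) (x b).
have := eucl_dist_triangle (x v) (x u) (x b).
rewrite (eucl_distC (x a) (x u)) (eucl_distC (x v) (x b)).
set r := r1 + _ in lens lent *; lra.
Qed.

(** Union bound: either some small cell holds fewer than [m] vertices, or the cells are full and
    some pair is not joined. A joined pair has stretch at most 4 (d/K + J d/(K L)) <= 8 d/K, as J <=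
    L. *)
Lemma prob_stretched (K L J s0 m0 m1 m : nat) (y eps : R) (e0 : vertex_pair n) :
  (0 < K)%N -> (0 < L)%N -> 0 <= y -> (0 < s0)%N -> (J <= L)%N ->
  8 * d%:R <= eps * K%:R ->
  (m0 + 2 * (s0 * 2 ^ J) + (2 + 2 * (s0 * 2 ^ J.+1)) <= m)%N ->
  (m1 + s0 + (2 + 2 * (s0 * 2 ^ J.+1)) <= L ^ d * m)%N ->
  (forall i, (4 * (1 - p / 2) ^+ m0) ^+ (s0 * 2 ^ i) <= y) ->
  2 ^+ s0 * (1 - p / 2) ^+ m1 <= y ->
  2 * ((1 - p / 2) ^+ (s0 * 2 ^ J).-1) ^+ (s0 * 2 ^ J) <= y ->
  (P (~` [set w | forall i j : 'I_n,
     ((eucl_dist (X i w) (X j w))%:E <= random_dist X G w i j)%E /\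
     (random_dist X G w i j <= (eucl_dist (X i w) (X j w) + eps)%:E)%E])
   <= ((K * L)%:R ^+ d * (2 ^+ m * (1 - (2 * (K * L)%:R ^+ d)^-1) ^+ n)
       + n%:R ^+ 2 * ((2 * J.+1).+1%:R * y))%:E)%E.
Proof.
move=> K0 L0 y0 s00 JL epsK m0P m1P ylayer yfirst ylast.
set A := [set w | _].
have K0' : 0 < K%:R :> R by rewrite ltr0n.
have L0' : 0 < L%:R :> R by rewrite ltr0n.
have KL0 : (0 < K * L)%N by rewrite muln_gt0 K0 L0.
have eps0 : 0 <= eps by rewrite -(pmulr_lge0 _ K0'); apply: le_trans epsK; rewrite mulr_ge0.
have mA : measurable A.
  have -> : A = \bigcap_(ij in [set: 'I_n * 'I_n]) [set w | (random_dist X G w ij.1 ij.2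
      <= (eucl_dist (X ij.1 w) (X ij.2 w) + eps)%:E)%E].
    apply/seteqP; split=> [w Aw [i j] _|w Aw i j]; first by have [] := Aw i j.
    by split; [exact: eucl_dist_le_graph_dist|exact: (Aw (i, j))].
  apply: fin_bigcap_measurable; first exact: finite_finset.
  move=> ij _; apply: measurable_random_dist_le.
  by apply: measurable_funD; [exact: measurable_eucl_dist|exact: measurable_cst].
pose co (f : {ffun 'I_n -> grid d (K * L)}) i := coarse L0 (f i).
pose crowded (f : {ffun 'I_n -> grid d (K * L)}) :=
  [forall c, (m <= #|[set i | f i == c]%SET|)%N].
pose Bad (f : {ffun 'I_n -> grid d (K * L)}) g := ~~ crowded f ||
  [exists u, exists v, (u != v) && ~~ joined (edge_of e0) (co f) f J g u v].
apply: (@le_trans _ _ (EX (@unif R d (K * L)) (fun f =>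
    EX (bern p) (fun g => (Bad f g)%:R)))%:E).
  apply: (prob_le_EX XG) => // f g.
  rewrite negb_or negbK => /andP[_ /existsPn nb] w wfg u v.
  split; first exact: eucl_dist_le_graph_dist.
  have [<-|uv] := eqVneq u v.
    apply: le_trans (graph_dist_le_walk (s := [::]) _ _) _ => //.
    by rewrite path_length_nil lee_fin addr_ge0// eucl_dist_ge0.
  have /existsPn/(_ v) := nb u; rewrite uv/= negbK.
  move=> /existsP[a /existsP[b /and3P[ua vb ab]]].
  have adjw := sample_adjacent e0 wfg.
  have sub : subrel (adjacent (edge_of e0) g) (fun a b => G a b w).
    by move=> c c'; rewrite adjw.
  have cor c c' : co f c = co f c' -> eucl_dist (X c w) (X c' w) <= d%:R * K%:R^-1.
    move=> cc'; apply: eucl_dist_le => [|k]; first by rewrite invr_ge0.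
    have slot_coarse i : slot (co f i k) (tnth (X i w) k).
      have scale (q : nat) : q%:R / K%:R = (q * L)%:R / (K * L)%:R :> R.
        by rewrite !natrM -mulf_div divff ?mulr1// gt_eqF.
      have := wfg.1 i k; rewrite /slot/= !in_itv/= /co ffunE/= !scale => /andP[lo hi].
      apply/andP; split.
        apply: le_trans lo; rewrite ler_pM2r ?invr_gt0 ?ltr0n// ler_nat.
        exact: leq_trunc_div.
      apply: lt_le_trans hi _; rewrite ler_pM2r ?invr_gt0 ?ltr0n// ler_nat.
      exact: ltn_ceil.
    by have := slot_coarse c'; rewrite -cc'; exact: slot_dist_le.
  have smr c c' : f c = f c' -> eucl_dist (X c w) (X c' w) <= d%:R * (K * L)%:R^-1.
    move=> cc'; apply: eucl_dist_le => [|k]; first by rewrite invr_ge0.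
    by have := wfg.1 c' k; rewrite -cc'; apply: slot_dist_le; exact: wfg.1.
  apply: le_trans (graph_dist_joined (reg_sym XG w) cor smr
    (near_subrel sub ua) (near_subrel sub vb) (sub _ _ ab)) _.
  rewrite lee_fin lerD2l.
  have h : J%:R * (d%:R * (K * L)%:R^-1) <= d%:R * K%:R^-1 :> R.
    rewrite mulrCA ler_wpM2l// natrM invfM mulrCA ler_piMr ?invr_ge0//.
    by rewrite ler_pdivrMr// mul1r ler_nat.
  apply: (@le_trans _ _ (8 * (d%:R * K%:R^-1))); first by move: h; lra.
  by rewrite mulrA ler_pdivrMr.
rewrite lee_fin.
apply: (@le_trans _ _ (EX (@unif R d (K * L)) (fun f =>
    \sum_c (#|[set i | f i == c]%SET| < m)%N%:R + n%:R ^+ 2 * ((2 * J.+1).+1%:R * y)))).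
  apply: le_EX => [|f]; first exact: unif_ge0.
  case: (boolP (crowded f)) => [/forallP cr|].
    rewrite ler_wpDl ?sumr_ge0//.
    apply: (@le_trans _ _ (EX (bern p) (fun g => \sum_u \sum_(v | u != v)
       (~~ joined (edge_of e0) (co f) f J g u v)%:R))).
      apply: le_EX => [|g]; first exact: bern_ge0.
      rewrite /Bad (_ : crowded f) ?orFb/=; last exact/forallP.
      case: (boolP [exists _, _]) => [|_]; last by rewrite sumr_ge0// => u _; rewrite sumr_ge0.
      move=> /existsP[u /existsP[v /andP[uv nj]]].
      rewrite (bigD1 u)//= (bigD1 v)//= nj -addrA lerDl addr_ge0//.
        by rewrite sumr_ge0.
      by rewrite sumr_ge0// => u' _; rewrite sumr_ge0.
    rewrite EX_sum.
    apply: (@le_trans _ _ (\sum_(u : 'I_n) \sum_(v : 'I_n) (2 * J.+1).+1%:R * y)).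
      apply: ler_sum => u _; rewrite EX_sum big_mkcond/=; apply: ler_sum => v _.
      case: ifPn => uv; last by rewrite mulr_ge0.
      apply: (prob_not_joined p01 (@edge_of_inj _ e0) y0 (s0 := s0) (m0 := m0) (m1 := m1)
        (M0 := m) (M1 := (L ^ d * m)%N)) => // a.
      exact: coarse_occupancy.
    by rewrite !sumr_const card_ord -!mulrnA -[leLHS]mulr_natl natrM expr2.
  rewrite negb_forall => /existsP[c]; rewrite -ltnNge => cm.
  apply: (@le_trans _ _ 1).
    rewrite -[leRHS](EX_cst (vertex_pair n) (bern_sum1 p) 1); apply: le_EX => [|g].
      exact: bern_ge0.
    by case: (Bad f g); rewrite ?ler01.
  rewrite (bigD1 c)//= cm -addrA lerDl addr_ge0 ?sumr_ge0//.
  by rewrite mulr_ge0 ?sqr_ge0// mulr_ge0.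
rewrite EXD EX_sum (EX_cst _ (unif_sum1 R d KL0)) lerD2r.
apply: (@le_trans _ _ (\sum_(c : grid d (K * L))
    2 ^+ m * (1 - (2 * (K * L)%:R ^+ d)^-1) ^+ n)).
  by apply: ler_sum => c _; have := occupancy R 'I_n m c KL0; rewrite card_ord.
by rewrite sumr_const card_ffun !card_ord -[leLHS]mulr_natl natrX.
Qed.

End FixedSize.

(** * Choice of the parameters *)

Section FixedSizeBounds.
Variables (dT : measure_display) (T : measurableType dT) (R : realType).
Variables (P : probability T R) (d n : nat) (p : R).
Variables (X : 'I_n -> {RV P >-> d.-tuple R}) (G : 'I_n -> 'I_n -> {RV P >-> bool}).
Hypothesis XG : random_embedded_graph p X G.
Hypothesis p01 : 0 <= p <= 1.
Hypothesis d_gt0 : (0 < d)%N.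

(** Here n p <= x^d with x = l / (omega ll^2). For M about 24 x and mu = d M, the bound
    [first_moment] needs is met, while mu D <= 26 l / (8 ll^2) <= 26 l / 72 < l / 2 because ll >=
    3. *)
Lemma prob_short_dist_le (omega : R) (u v : 'I_n) : u != v ->
  0 < omega -> 3 <= ln (ln n%:R : R) -> 0 < ln n%:R :> R ->
  p <= (omega ^+ d * ln (ln n%:R) ^+ (2 * d))^-1 * (ln n%:R ^+ d / n%:R) ->
  (P (~` [set w | ((omega / (8%:R * d%:R * expR 1 ^+ d))%:E
       <= random_dist X G w u v)%E]) <= (expR (- (ln n%:R / 2)))%:E)%E.
Proof.
move=> uv om0 ll3 l0; set l := ln n%:R in ll3 l0 *; set ll := ln l in ll3 *.
have n0 : (0 < n)%N := leq_ltn_trans (leq0n _) (ltn_ord u).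
have n0' : 0 < n%:R :> R by rewrite ltr0n.
have d0' : 0 < d%:R :> R by rewrite ltr0n.
move=> ple; set D := omega / _.
have ll0 : 0 < ll by lra.
pose x := l / (omega * ll ^+ 2).
have x0 : 0 < x by rewrite divr_gt0// mulr_gt0// exprn_gt0.
have npx : n%:R * p <= x ^+ d.
  apply: (le_trans (ler_wpM2l (ltW n0') ple)).
  rewrite /x exprMn exprVn exprMn exprM le_eqVlt; apply/orP; left; apply/eqP.
  by field; rewrite !expf_neq0 ?gt_eqF// exprn_gt0.
have invn : n%:R^-1 = expR (- l) :> R by rewrite expRN lnK// posrE.
have half z : 0 <= z -> z <= 2^-1 -> z ^+ d <= 2^-1 :> R.
  move=> z0 z2; apply: le_trans (z2); case: d d_gt0 => // k _.
  by rewrite exprS ler_piMr// exprn_ile1//; lra.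
have [p0 p1] := andP p01.
(* When [omega] is huge, lengths are irrelevant: u and v are not even joined
   by a path, since the mean degree is below 1/2. *)
have [x2|x2] := leP x 2^-1.
  apply: le_trans (prob_short_dist XG p01 (M := 1) (h := fun _ _ => 1)
    (kappa := 1) (mu := 0) _ _ uv _ _ _ _ _) _ => //.
  - by move=> c'; under eq_bigr do rewrite mulr1; rewrite unif_sum1.
  - by move=> c c' x' y' _ _; rewrite mul0r oppr0 expR0.
  - by rewrite mulr1 (le_trans npx)// half// ltW.
  - by rewrite mul0r expR0 mul1r invn lee_fin ler_expR; lra.
(* M >= 24 x makes n p kappa at most 2^(-d); the rounding is absorbed in 26 x because x > 1/2. *)
pose M := (Num.truncn (24 * x)).+1.
have x24 : 0 <= 24 * x by lra.
have Mlb : 24 * x <= M%:R by rewrite ltW// truncnS_gt.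
have Mub : M%:R <= 26 * x.
  have : (Num.truncn (24 * x))%:R <= 24 * x by rewrite truncn_le.
  by rewrite /M -addn1 natrD; lra.
have M0 : 0 < M%:R :> R by rewrite ltr0n.
apply: le_trans (prob_short_dist XG p01 (M := M) (h := @grid_kernel R d M)
  (kappa := (12 / M%:R) ^+ d) (mu := (d * M)%:R) _ _ uv _ _ _ _ _) _ => //.
- exact: grid_kernel_ge0.
- exact: grid_kernel_mean.
- exact: expR_eucl_dist_le_kernel.
- rewrite mulrA; apply: le_trans (ler_wpM2r _ npx) _.
    by rewrite exprn_ge0// divr_ge0// ltW.
  rewrite -exprMn; apply: half.
    by apply: mulr_ge0; [exact: ltW | rewrite divr_ge0].
  by rewrite mulrA ler_pdivrMr//; lra.
- rewrite invn -expRD lee_fin ler_expR.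
  have e1 : 1 <= expR 1 ^+ d :> R.
    by rewrite exprn_ege1//; have /andP[] := expR1_bounds R; lra.
  have -> : (d * M)%:R * D = M%:R * omega / 8 / expR 1 ^+ d.
    by rewrite /D natrM; field; rewrite !gt_eqF// exprn_gt0 ?expR_gt0.
  have M_om : M%:R * omega <= 26 * (l / ll ^+ 2).
    apply: le_trans (ler_wpM2r (ltW om0) Mub) _; rewrite le_eqVlt; apply/orP; left.
    by apply/eqP; rewrite /x; field; rewrite !gt_eqF.
  have lll : l / ll ^+ 2 <= l / 9.
    rewrite ler_pM2l// lef_pV2 ?posrE ?exprn_gt0//.
    by have := ler_pM (ler0n R 3) (ler0n R 3) ll3 ll3; rewrite -expr2; lra.
  have : M%:R * omega / 8 / expR 1 ^+ d <= M%:R * omega / 8.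
    rewrite ler_piMr ?invf_le1 ?(lt_le_trans _ e1)//.
    by rewrite divr_ge0// mulr_ge0// ltW.
  by move: M_om lll; lra.
Qed.

Lemma onem_half_le_expR (k : nat) (z : R) : z <= p * k%:R / 2 ->
  (1 - p / 2) ^+ k <= expR (- z).
Proof.
move=> zk; have [p0 p1] := andP p01.
apply: (@le_trans _ _ (expR (- (p / 2)) ^+ k)).
  by rewrite lerXn2r ?nnegrE ?expR_ge0//; [lra|exact: expR_ge1Dx].
by rewrite -expRM_natl ler_expR; lra.
Qed.

(** [N] counts the small cells, and [q] is at most an eighth of their mean occupancy. Cells are
    required to hold 2 q vertices, of which q stay available in every round. The two terms of
    [prob_stretched] are at most e^(-L) and 3 e^(-L). *)
Lemma prob_stretched_le (K J : nat) (eps : R) :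
  let L := J.+1 in let N := ((K * L) ^ d)%N in let q := (n %/ (8 * N))%N in
  (0 < K)%N -> 8 * d%:R <= eps * K%:R -> (4 ^ J <= n < 4 ^ L)%N -> (1 < n)%N ->
  (6 * (6 * L * 2 ^ J) + 2 <= q)%N -> (N <= q)%N -> 24 <= p * q%:R ->
  (P (~` [set w | forall i j : 'I_n,
     ((eucl_dist (X i w) (X j w))%:E <= random_dist X G w i j)%E /\
     (random_dist X G w i j <= (eucl_dist (X i w) (X j w) + eps)%:E)%E])
   <= (4 / L%:R)%:E)%E.
Proof.
move=> L N q K0 epsK /andP[nJ nL] n1 Tq Nq pq.
have [p0 p1] := andP p01.
have e0 : vertex_pair n.
  by exists (Ordinal (ltnW n1), Ordinal n1).
have L0 : (0 < L)%N by [].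
have L1 : 1 <= L%:R :> R by rewrite ler1n.
have N0 : (0 < N)%N by rewrite expn_gt0 muln_gt0 K0.
have N1 : 1 <= N%:R :> R by rewrite ler1n.
have N0' : 0 < N%:R :> R by rewrite ltr0n.
have [e2 e4] := andP (expR1_bounds R).
have four : 4 <= expR 2 :> R.
  have -> : expR 2 = expR 1 * expR 1 :> R by rewrite -expRD; congr expR; lra.
  by have := ler_pM (ler0n R 2) (ler0n R 2) e2 e2; lra.
pose s0 := (6 * L)%N; pose y : R := expR (- s0%:R).
set Tn := (6 * L * 2 ^ J)%N in Tq.
have eT : (s0 * 2 ^ J = Tn)%N by [].
have eT2 : (s0 * 2 ^ J.+1 = 2 * Tn)%N by rewrite expnS mulnCA.
have s0T : (s0 <= Tn)%N by rewrite -eT leq_pmulr// expn_gt0.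
have Ld : (L <= L ^ d)%N by rewrite -[leqLHS]expn1 leq_pexp2l.
have two (k : nat) : 2 ^+ k <= expR k%:R :> R.
  by rewrite -[k%:R]mulr1 expRM_natl lerXn2r ?nnegrE ?expR_ge0//.
have s00 : (0 < s0)%N by [].
have Lq : (L <= q)%N by move: Tq s0T; rewrite /s0; clear; lia.
apply: le_trans (prob_stretched XG p01 (K := K) (L := L) (J := J) (s0 := s0)
  (m0 := q) (m1 := (L ^ d * q)%N) (m := (2 * q)%N) (y := y) e0
  K0 L0 (expR_ge0 _) s00 (leqnSn J) epsK _ _ _ _ _) _.
- by rewrite eT eT2; move: Tq; clear; lia.
- have : (q <= L ^ d * q)%N by rewrite leq_pmull// expn_gt0.
  rewrite eT2 (mulnCA (L ^ d)%N); move: (L ^ d * q)%N => z.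
  by move: Tq s0T; clear; lia.
(* Each factor is at most e^2 e^(-3), and there are at least [s0] of them. *)
- move=> i; apply: (@le_trans _ _ (expR (-1) ^+ (s0 * 2 ^ i))).
    rewrite lerXn2r ?nnegrE ?expR_ge0 ?mulr_ge0 ?exprn_ge0//; first by lra.
    have h : (1 - p / 2) ^+ q <= expR (- 3) by apply: onem_half_le_expR; lra.
    have -> : expR (-1) = expR 2 * expR (- 3) :> R by rewrite -expRD; congr expR; lra.
    by rewrite ler_pM ?exprn_ge0//; lra.
  rewrite -expRM_natl ler_expR mulrN1 lerN2 ler_nat leq_pmulr// expn_gt0//.
(* Since L <= L^d, p m1 / 2 >= 12 L = 2 s0, which beats 2^s0 with e^(-s0) to spare. *)
- have -> : y = expR s0%:R * expR (- (2 * s0%:R)) by rewrite -expRD /y; congr expR; lra.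
  rewrite ler_pM ?exprn_ge0//; first by lra.
  apply: onem_half_le_expR; rewrite natrM.
  have : 24 * L%:R <= p * q%:R * (L ^ d)%:R by rewrite ler_pM// ler_nat.
  by rewrite /s0 natrM; lra.
(* The last layers span about T^2 = 36 L^2 4^J >= 9 L^2 n pairs; with p n >= 24 the exponent exceeds
   1 + 6 L. *)
- rewrite eT -exprM.
  have -> : y = expR 1 * expR (- (1 + s0%:R)) by rewrite -expRD /y; congr expR; lra.
  rewrite ler_pM ?exprn_ge0//; first by lra.
  apply: onem_half_le_expR.
  have q_n : (q <= n)%N by rewrite leq_div.
  have TT : (9 * L * L * n <= 2 * (Tn.-1 * Tn))%N.
    have : (n <= 4 * 4 ^ J)%N by rewrite -expnS ltnW.
    have : (Tn * Tn = 36 * L * L * 4 ^ J)%N.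
      have -> : (4 ^ J = 2 ^ J * 2 ^ J)%N by rewrite -expnMn.
      by rewrite /Tn; move: (2 ^ J)%N (L); clear; lia.
    have : (Tn <= 2 * Tn.-1)%N.
      by move: s0T; rewrite /s0; clear; lia.
    move: (4 ^ J)%N => r h1 h2 h3.
    have h4 : (Tn * Tn <= 2 * Tn.-1 * Tn)%N by rewrite leq_mul2r h1 orbT.
    have h5 : (9 * L * L * n <= 9 * L * L * (4 * r))%N by rewrite leq_mul2l h3 orbT.
    rewrite mulnA (leq_trans _ h4)// h2 (leq_trans h5)//.
    by rewrite mulnA (mulnC _ 4) !mulnA.
  have TT' : 9 * L%:R * L%:R * n%:R <= 2 * (Tn.-1 * Tn)%:R :> R.
    by rewrite -!natrM ler_nat.
  have h6 := ler_wpM2l p0 TT'.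
  have pn : 24 <= p * n%:R by rewrite (le_trans pq)// ler_wpM2l// ler_nat.
  have h7 : 9 * (L%:R * L%:R) * 24 <= 9 * (L%:R * L%:R) * (p * n%:R) :> R.
    by rewrite ler_wpM2l.
  have h8 : L%:R <= L%:R * L%:R :> R by rewrite ler_peMr.
  by rewrite /s0 natrM; lra.
rewrite lee_fin.
have expL : expR (- L%:R) <= L%:R^-1 :> R.
  rewrite expRN lef_pV2 ?posrE ?expR_gt0 ?(lt_le_trans _ L1)//.
  by have := expR_ge1Dx (L%:R : R); lra.
have first_term : (K * L)%:R ^+ d * (2 ^+ (2 * q) * (1 - (2 * (K * L)%:R ^+ d)^-1) ^+ n)
    <= expR (- L%:R) :> R.
  rewrite -natrX -/N.
  have h1 : (1 - (2 * N%:R)^-1) ^+ n <= expR (- (4 * q%:R)) :> R.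
    apply: (@le_trans _ _ (expR (- (2 * N%:R)^-1) ^+ n)).
      rewrite lerXn2r ?nnegrE ?expR_ge0 ?expR_ge1Dx// subr_ge0 invf_le1 ?mulr_gt0//.
      by lra.
    rewrite -expRM_natl ler_expR mulrN lerN2 ler_pdivlMr ?mulr_gt0//.
    have : (q * (8 * N) <= n)%N by rewrite leq_trunc_div.
    by rewrite -(ler_nat R) !natrM; lra.
  have h2 : N%:R <= expR q%:R :> R.
    have : N%:R <= q%:R :> R by rewrite ler_nat.
    by have := expR_ge1Dx (q%:R : R); lra.
  have h3 := two (2 * q)%N.
  have base0 : 0 <= (1 - (2 * N%:R)^-1) ^+ n :> R.
    rewrite exprn_ge0// subr_ge0 invf_le1 ?mulr_gt0//.
    by lra.
  apply: (@le_trans _ _ (expR q%:R * (expR (2 * q)%:R * expR (- (4 * q%:R))))).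
    apply: ler_pM => //; first by apply: mulr_ge0 => //; exact: exprn_ge0.
    by apply: ler_pM => //; exact: exprn_ge0.
  rewrite -!expRD ler_expR natrM.
  have : L%:R <= q%:R :> R by rewrite ler_nat.
  by lra.
(* The pairs cost e^(4 L) and the rounds 3 e^L; [y = e^(-6 L)] leaves 3 e^(-L), whence the 6 in
   [s0]. *)
have second_term : n%:R ^+ 2 * ((2 * J.+1).+1%:R * y) <= 3 * expR (- L%:R) :> R.
  have h1 : n%:R <= expR (2 * L%:R) :> R.
    apply: (@le_trans _ _ (4 ^+ L)); first by rewrite -natrX ler_nat ltnW.
    by rewrite mulrC expRM_natl lerXn2r ?nnegrE ?expR_ge0.
  have h2 : n%:R ^+ 2 <= expR (4 * L%:R) :> R.
    have -> : expR (4 * L%:R) = expR (2 * L%:R) ^+ 2 :> R.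
      by rewrite -expRM_natl; congr expR; lra.
    by rewrite lerXn2r ?nnegrE ?expR_ge0.
  have h3 : (2 * J.+1).+1%:R <= 3 * expR L%:R :> R.
    rewrite -addn1 natrD natrM -/L; have := expR_ge1Dx (L%:R : R); lra.
  apply: (@le_trans _ _ (expR (4 * L%:R) * (3 * expR L%:R * y))).
    rewrite ler_pM ?sqr_ge0 ?mulr_ge0 ?expR_ge0//.
    by rewrite ler_wpM2r ?expR_ge0.
  have -> : expR (4 * L%:R) * (3 * expR L%:R * y) = 3 * expR (4 * L%:R + L%:R - s0%:R).
    by rewrite !expRD /y; ring.
  by rewrite ler_wpM2l// ler_expR /s0 natrM; lra.
by move: first_term second_term expL; lra.
Qed.

End FixedSizeBounds.

(** * Asymptotics and the conclusion *)

Lemma pow_le_exp2 (c k : nat) :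
  exists J0, forall J, (J0 <= J)%N -> (c * J.+1 ^ k <= 2 ^ J)%N.
Proof.
(* With a about J/(k+1), 2^J >= (a+1)^(k+1) and (J+1)^k <= (k+1)^k (a+1)^k; this threshold lets the
   spare factor a+1 absorb c (k+1)^k. *)
exists (k.+1 * (c * k.+1 ^ k))%N => J leJ.
have leq2 (a : nat) : (a < 2 ^ a)%N by exact: ltn_expl.
pose a := (J %/ k.+1)%N.
have aJ : (c * k.+1 ^ k <= a.+1)%N by rewrite leqW// leq_divRL// mulnC.
have Ja : (J.+1 <= k.+1 * a.+1)%N by rewrite mulnC ltn_ceil.
apply: (@leq_trans (a.+1 ^ k.+1)); last first.
  rewrite (@leq_trans ((2 ^ a) ^ k.+1))// ?leq_exp2r//.
  by rewrite -expnM leq_exp2l// leq_trunc_div.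
apply: (@leq_trans (c * (k.+1 * a.+1) ^ k)).
  rewrite leq_mul2l; apply/orP; right.
  by move: Ja; case: (k in (_ ^ k <= _ ^ k)%N) => // k' Ja; rewrite leq_exp2r.
by rewrite expnMn mulnA expnS leq_mul2r aJ orbT.
Qed.

Lemma cell_count_bounds (d K J n : nat) :
  let L := J.+1 in let N := ((K * L) ^ d)%N in let q := (n %/ (8 * N))%N in
  (0 < K)%N -> (312 * K ^ (2 * d) * L ^ (2 * d).+1 <= 2 ^ J)%N -> (4 ^ J <= n)%N ->
  (6 * (6 * L * 2 ^ J) + 2 <= q)%N /\ (N <= q)%N.
Proof.
move=> L N q K0 cJ nJ.
have N0 : (0 < N)%N by rewrite expn_gt0 muln_gt0 K0.
have L0 : (0 < L)%N by [].
have e : (312 * K ^ (2 * d) * L ^ (2 * d).+1 = 312 * (N * N * L))%N.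
  rewrite expnS (mulnC 2) !expnM -!mulnA; congr (_ * _)%N.
  by rewrite /N !expnMn -!mulnn; ring.
(* 36 L 2^J + 2 <= 38 L 2^J explains 38; then 38 L + N <= 39 N L and 312 = 8 * 39. *)
have bound : (8 * N * (38 * L + N) <= 2 ^ J)%N.
  apply: leq_trans cJ; rewrite e.
  have : (L <= N * L)%N by rewrite leq_pmull.
  have : (N <= N * L)%N by rewrite leq_pmulr.
  move: (N * L)%N (mulnA N N L) => z <-{e} Nz Lz.
  have : (N * (38 * L + N) <= N * (39 * z))%N by rewrite leq_mul2l; apply/orP; right; lia.
  by rewrite -!mulnA; lia.
have J1 : (0 < 2 ^ J)%N by rewrite expn_gt0.
have qq : (2 ^ J * (38 * L + N) <= q)%N.
  rewrite leq_divRL ?muln_gt0//; apply: leq_trans nJ.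
  have -> : (4 ^ J = 2 ^ J * 2 ^ J)%N by rewrite -expnMn.
  by rewrite -mulnA leq_mul2l mulnC bound orbT.
move: qq; move: (2 ^ J)%N J1 => r r0 qq.
have h1 : (N <= r * N)%N by rewrite leq_pmull.
have h2 : (1 <= r * L)%N by rewrite muln_gt0 r0.
by move: qq h1 h2; rewrite mulnDr; clear; lia.
Qed.


Lemma prob_cvg0 (R : realType) (f : nat -> \bar R) :
  (forall n, 0 <= f n)%E ->
  (forall e : R, 0 < e -> \forall n \near \oo, (f n <= e%:E)%E) ->
  f @ \oo --> 0%E.
Proof.
move=> f0 fe; apply/fine_cvgP; split.
  have := fe 1 ltr01; apply: filterS => n fn1.
  by rewrite ge0_fin_numE// (le_lt_trans fn1)// ltry.
apply/cvgr0Pnorm_le => e e0; have := fe e e0; apply: filterS => n fne /=.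
rewrite ger0_norm; last exact: fine_ge0.
rewrite -lee_fin fineK// ge0_fin_numE// (le_lt_trans fne)// ltry//.
Qed.

Lemma near_ln_ge (R : realType) (A : R) : \forall n \near \oo, A <= ln n%:R.
Proof.
have := nbhs_infty_ger (expR A); apply: filterS => n An.
by rewrite -[A]expRK ler_ln ?posrE ?expR_gt0// (lt_le_trans (expR_gt0 A)).
Qed.

Lemma near_lnln_ge (R : realType) (A : R) : \forall n \near \oo, A <= ln (ln n%:R).
Proof.
have := near_ln_ge (expR A); apply: filterS => n An.
by rewrite -[A]expRK ler_ln ?posrE ?expR_gt0// (lt_le_trans (expR_gt0 A)).
Qed.

Lemma near_trunc_log (J0 : nat) : \forall n \near \oo, (J0 <= trunc_log 4 n)%N.
Proof.
have := nbhs_infty_ge (4 ^ J0); apply: filterS => n nJ.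
exact: trunc_log_max.
Qed.

(** From n >= 4^J >= e^J, ln n >= J >= L/2, so N <= (2 K)^d ln^d n and p n >= 384 N. As n <= 16 N q,
    and 384 = 24 * 16, the claim follows. *)
Lemma mean_degree_bound (R : realType) (d K n : nat) (omega p : R) :
  let J := trunc_log 4 n in let L := J.+1 in let N := ((K * L) ^ d)%N in
  let q := (n %/ (8 * N))%N in
  (0 < K)%N -> (0 < J)%N -> (0 < q)%N -> (0 < n)%N ->
  384 * (2 * K%:R) ^+ d <= omega -> omega * ln n%:R ^+ d / n%:R <= p ->
  24 <= p * q%:R.
Proof.
move=> J L N q K0 J0 q0 n0 omK ple.
have N0 : (0 < N)%N by rewrite expn_gt0 muln_gt0 K0.
have n0' : 0 < n%:R :> R by rewrite ltr0n.
have K0' : 0 < K%:R :> R by rewrite ltr0n.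
have L0' : 0 < L%:R :> R by rewrite ltr0n.
have Kd : 0 < (2 * K%:R) ^+ d :> R by rewrite exprn_gt0// mulr_gt0.
have om0 : 0 <= omega by exact: le_trans (mulr_ge0 (ler0n R 384) (ltW Kd)) omK.
have lnJ : L%:R / 2 <= ln n%:R :> R.
  apply: (@le_trans _ _ J%:R).
    by rewrite ler_pdivrMr// -natrM ler_nat /L; move: (J) J0; clear; lia.
  rewrite -[J%:R]expRK ler_ln ?posrE ?expR_gt0//.
  apply: (@le_trans _ _ (4 ^ J)%:R); last by rewrite ler_nat trunc_logP.
  rewrite natrX -[J%:R]mulr1 expRM_natl lerXn2r ?nnegrE ?expR_ge0//.
  by have /andP[] := expR1_bounds R.
have nq : n%:R <= 16 * N%:R * q%:R :> R.
  have : (n < q.+1 * (8 * N))%N by rewrite ltn_ceil// muln_gt0.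
  have : (q.+1 * (8 * N) <= 2 * q * (8 * N))%N.
    by rewrite leq_mul2r; apply/orP; right; move: q0; clear; lia.
  move=> h1 h2; rewrite -!natrM ler_nat.
  apply: leq_trans (ltnW h2) (leq_trans h1 _).
  by move: (N) (q); clear; lia.
have pow : (L%:R / 2) ^+ d <= ln n%:R ^+ d :> R.
  by rewrite lerXn2r ?nnegrE ?divr_ge0// (le_trans _ lnJ)// divr_ge0.
have L2 : 0 <= (L%:R / 2) ^+ d :> R by rewrite exprn_ge0// divr_ge0.
have key : 384 * N%:R <= omega * ln n%:R ^+ d.
  have -> : N%:R = (2 * K%:R) ^+ d * (L%:R / 2) ^+ d :> R.
    by rewrite -exprMn natrX natrM; congr (_ ^+ _); field.
  by rewrite mulrA; exact: ler_pM (mulr_ge0 (ler0n R 384) (ltW Kd)) L2 omK pow.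
have p0 : 0 <= p.
  apply: le_trans ple; rewrite divr_ge0// mulr_ge0// (le_trans _ pow)//.
have N0' : 0 < N%:R :> R by rewrite ltr0n.
have h3 : 384 * N%:R <= p * n%:R.
  by rewrite (le_trans key)// -ler_pdivrMr.
have h4 := ler_wpM2l p0 nq.
have h5 : 24 * (16 * N%:R) <= p * q%:R * (16 * N%:R) by lra.
by rewrite -(ler_pM2r (_ : 0 < 16 * N%:R)) ?mulr_gt0.
Qed.

Theorem theorem1p1 (R : realType) (d : nat) (d_ge1 : (1 <= d)%N)
    (omega : nat -> R) (omega_infty : omega @ \oo --> +oo)
    (p : nat -> R) (p01 : forall n, 0 <= p n <= 1)
    (dT : nat -> measure_display) (T : forall n, measurableType (dT n))
    (P : forall n, probability (T n) R)
    (X : forall n, 'I_n -> {RV (P n) >-> d.-tuple R})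
    (G : forall n, 'I_n -> 'I_n -> {RV (P n) >-> bool})
    (XG : forall n, random_embedded_graph (p n) (X n) (G n)) :
  ((\forall n \near \oo,
      p n <= (omega n ^+ d * ln (ln n%:R) ^+ (2 * d))^-1
             * (ln n%:R ^+ d / n%:R)) ->
   forall u v : nat -> nat,
     (\forall n \near \oo, [/\ (u n < n)%N, (v n < n)%N & u n != v n]) ->
     asymptotically_almost_surely P (fun n =>
       [set w | forall i j : 'I_n, i = u n :> nat -> j = v n :> nat ->
          ((omega n / (8%:R * d%:R * expR 1 ^+ d))%:E
             <= random_dist (X n) (G n) w i j)%E]))
  /\
  ((\forall n \near \oo, omega n * ln n%:R ^+ d / n%:R <= p n) ->
   forall eps : R, 0 < eps ->
     asymptotically_almost_surely P (fun n =>
       [set w | forall i j : 'I_n,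
          ((eucl_dist (X n i w) (X n j w))%:E
             <= random_dist (X n) (G n) w i j)%E /\
          (random_dist (X n) (G n) w i j
             <= (eucl_dist (X n i w) (X n j w) + eps)%:E)%E])).
Proof.
have n_unbounded (A : R) : \forall n \near \oo, A <= omega n.
  by move/cvgryPge : omega_infty; exact.
split=> [ple u v uv|ple eps eps0].
(* Once [u n] and [v n] are vertices, the quantified event concerns a single pair; for other [n]
   only its measurability matters. *)
- have exact_event n (i0 j0 : 'I_n) : i0 = u n :> nat -> j0 = v n :> nat ->
      [set w | forall i j : 'I_n, i = u n :> nat -> j = v n :> nat ->
         ((omega n / (8%:R * d%:R * expR 1 ^+ d))%:E
            <= random_dist (X n) (G n) w i j)%E] =
      [set w | ((omega n / (8%:R * d%:R * expR 1 ^+ d))%:E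
            <= random_dist (X n) (G n) w i0 j0)%E].
    move=> iu jv; apply/seteqP; split=> w /=; first exact.
    move=> h i j iu' jv'.
    have -> : i = i0 by apply: ord_inj; rewrite iu' iu.
    have -> : j = j0 by apply: ord_inj; rewrite jv' jv.
    exact: h.
  split=> [n|].
    have -> : [set w | forall i j : 'I_n, i = u n :> nat -> j = v n :> nat ->
         ((omega n / (8%:R * d%:R * expR 1 ^+ d))%:E
            <= random_dist (X n) (G n) w i j)%E] =
      \bigcap_(ij in [set ij : 'I_n * 'I_n | ij.1 = u n :> nat /\ ij.2 = v n :> nat])
        [set w | ((omega n / (8%:R * d%:R * expR 1 ^+ d))%:E
            <= random_dist (X n) (G n) w ij.1 ij.2)%E].
      apply/seteqP; split=> w /= h; first by move=> [i j] [] /=; exact: h.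
      by move=> i j iu jv; exact: (h (i, j)).
    apply: fin_bigcap_measurable; first exact: finite_finset.
    by move=> ij _; apply: measurable_le_random_dist; exact: measurable_cst.
  apply: prob_cvg0 => [n|e e0]; first exact: measure_ge0.
  near=> n.
  have [un vn neq] : [/\ (u n < n)%N, (v n < n)%N & u n != v n] by near: n.
  rewrite (exact_event n (Ordinal un) (Ordinal vn))//.
  apply: le_trans (prob_short_dist_le (XG n) (p01 n) d_ge1 _ _ _ _ _) _.
  + by rewrite -val_eqE.
  + by rewrite (lt_le_trans (@ltr01 R))//; near: n; exact: n_unbounded.
  + by near: n; exact: near_lnln_ge.
  + by rewrite (lt_le_trans (@ltr01 R))//; near: n; exact: near_ln_ge.
  + by near: n.
  rewrite lee_fin -[leRHS]lnK ?posrE// ler_expR lerNl.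
  by rewrite ler_pdivlMr//; near: n; exact: near_ln_ge.
split=> [n|].
  have -> : [set w | forall i j : 'I_n,
      ((eucl_dist (X n i w) (X n j w))%:E <= random_dist (X n) (G n) w i j)%E /\
      (random_dist (X n) (G n) w i j <= (eucl_dist (X n i w) (X n j w) + eps)%:E)%E] =
    \bigcap_(ij in [set: 'I_n * 'I_n]) [set w | (random_dist (X n) (G n) w ij.1 ij.2
      <= (eucl_dist (X n ij.1 w) (X n ij.2 w) + eps)%:E)%E].
    apply/seteqP; split=> [w Aw [i j] _|w Aw i j]; first by have [] := Aw i j.
    by split; [exact: eucl_dist_le_graph_dist|exact: (Aw (i, j))].
  apply: fin_bigcap_measurable; first exact: finite_finset.
  move=> ij _; apply: measurable_random_dist_le.
  by apply: measurable_funD; [exact: measurable_eucl_dist|exact: measurable_cst].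
apply: prob_cvg0 => [n|e e0]; first exact: measure_ge0.
(* The coarse grid depends on [d] and [eps] alone, so it is fixed before [n] grows. *)
pose K := (Num.truncn (8 * d%:R / eps)).+1.
have epsK : 8 * d%:R <= eps * K%:R.
  by rewrite [leRHS]mulrC -ler_pdivrMr// ltW// truncnS_gt.
have [J0 J0P] := pow_le_exp2 (312 * K ^ (2 * d)) (2 * d).+1.
near=> n.
pose J := trunc_log 4 n.
have JJ0 : (J0 <= J)%N by rewrite /J; near: n; exact: near_trunc_log.
have Jpos : (0 < J)%N by rewrite /J; near: n; exact: near_trunc_log.
have n1 : (1 < n)%N by near: n; exact: nbhs_infty_ge.
have nJ : (4 ^ J <= n < 4 ^ J.+1)%N.
  by rewrite trunc_logP ?(ltnW n1)// trunc_log_ltn.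
have [nJ1 nJ2] := andP nJ.
have [Tq Nq] := @cell_count_bounds d K J n isT (J0P J JJ0) nJ1.
have q0 : (0 < n %/ (8 * (K * J.+1) ^ d))%N by apply: leq_trans Nq; rewrite expn_gt0.
have deg : 24 <= p n * (n %/ (8 * (K * J.+1) ^ d))%:R.
  apply: (@mean_degree_bound R d K n (omega n)) => //; first exact: ltnW.
    by near: n; exact: n_unbounded.
  by near: n.
apply: le_trans (prob_stretched_le (XG n) (p01 n) d_ge1 _ epsK nJ n1 Tq Nq deg) _ => //.
rewrite lee_fin ler_pdivrMr ?ltr0n// mulrC -ler_pdivrMr//.
apply: (@le_trans _ _ (Num.truncn (4 / e)).+1%:R); first by rewrite ltW// truncnS_gt.
by rewrite ler_nat; apply: leqW; rewrite /J; near: n; exact: near_trunc_log.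
Unshelve. all: by end_near.
Qed.
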